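(* Let $\mathsf{N}_n$ be a uniformly random simplex tree-child network with $n$ taxa, and let $w_n$ be chosen uniformly at random among its leaves. There exists a deterministic infinite rooted network $(\hat{\mathsf{N}}^{\mathrm{lf}},\ell_0)$, namely the one constructed in the context, such that $(\mathsf{N}_n,w_n)\xrightarrow{d}(\hat{\mathsf{N}}^{\mathrm{lf}},\ell_0)$ in the local weak sense as $n\to\infty$.
   Context: A simplex tree-child network on a finite set $X$ is a finite directed acyclic graph $N=(V,E)$ with a root $o$ and with leaves bijectively labelled by $X$, such that: the root has (indegree, outdegree) $=(0,1)$; every vertex is reachable from $o$ by a directed path; every leaf has degree $(1,0)$; every vertex that is neither the root nor a leaf is either a tree vertex, of degree $(1,2)$, or a reticulation vertex, of degree $(2,1)$; (tree-child) every non-leaf vertex has at least one child that is a tree vertex or a leaf; (one-component) the unique child of every reticulation vertex is a leaf. Networks are considered up to isomorphism preserving leaf labels. $\mathsf{N}_n$ is uniform on the finite set of simplex tree-child networks with leaf label set $[n]$. Local neighbourhoods: for a directed graph $N$ and $v\in V(N)$, $U_R(N,v)$ is the subgraph induced by the vertices at undirected graph distance at most $R$ from $v$, rooted at $v$. Each vertex carries a mark giving its type in $N$ (root, tree vertex, reticulation, or leaf); leaf labels are ignored. $\cong$ denotes isomorphism of rooted directed marked graphs, i.e. a bijection of vertex sets preserving root, marks, edges and edge orientations. Local weak convergence $(N_n,v_n)\xrightarrow{d}(N,v)$ means $\mathbb{P}(U_R(N_n,v_n)\cong G)\to\mathbb{P}(U_R(N,v)\cong G)$ for every fixed $R\ge0$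 and every finite rooted directed marked graph $G$; for deterministic $(N,v)$ this is $\mathbb{P}(U_R(N_n,v_n)\cong U_R(N,v))\to1$ for every $R\ge0$. Construction. A bi-infinite spine is a bi-infinite directed path $\cdots\to x_{-1}\to x_0\to x_1\to\cdots$ of tree vertices. To decorate a tree vertex $x$ means: give $x$ a new reticulation child $\rho(x)$; give $\rho(x)$ a new leaf child $\ell(x)$; and give $\rho(x)$ a second parent $w(x)$, which is a tree vertex on a new bi-infinite spine, all of whose vertices other than $w(x)$ are in turn decorated, recursively (the reticulation child of $w(x)$ is $\rho(x)$). All spines and vertices introduced at every level are pairwise distinct. The network $\hat{\mathcal{R}}$ has two disjoint bi-infinite spines $\cdots\to p_{-1}\to p_0\to p_1\to\cdots$ and $\cdots\to q_{-1}\to q_0\to q_1\to\cdots$, and a reticulation $\rho_0$ whose two parents are $p_0$ and $q_0$ and whose only child is a leaf $\ell_0$; every spine vertex $p_i,q_i$ with $i\ne0$ is decorated, while $p_0,q_0$ have $\rho_0$ as their only reticulation child. The leaf limit $\hat{\mathsf{N}}^{\mathrm{lf}}$ is the same directed graph $\hat{\mathcal{R}}$, but rooted at $\ell_0$. *)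

(* Defs.v *)
From HB Require Import structures.
From mathcomp Require Import all_boot all_order all_algebra finmap.
From mathcomp Require Import all_classical all_reals all_analysis.

Set Implicit Arguments.
Unset Strict Implicit.
Unset Printing Implicit Defensive.

Import Order.TTheory GRing.Theory Num.Theory.
Import numFieldNormedType.Exports.

Local Open Scope classical_set_scope.

Inductive kind := RootKind | TreeKind | RetKind | LeafKind.

(** * Rooted directed marked graphs and local convergence *)

Record mgraph := MGraph {
  vertex : Type;
  arc : vertex -> vertex -> Prop;
  mark : vertex -> kind;
  root : vertex }.

Definition finite_mgraph (G : mgraph) : Prop := finite_set [set: vertex G].

Definition mgraph_iso (G H : mgraph) : Prop :=
  exists f : vertex G -> vertex H,
    [/\ bijective f,
        f (root G) = root H,
        forall v, mark (f v) = mark v &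
        forall u v, arc (f u) (f v) <-> arc u v].

Fixpoint dist_le (G : mgraph) (r : nat) (u v : vertex G) : Prop :=
  if r is r'.+1 then
    u = v \/ exists w, (arc u w \/ arc w u) /\ dist_le r' w v
  else u = v.

Definition ball_set (G : mgraph) (r : nat) : set (vertex G) :=
  [set v | dist_le r (root G) v].

Arguments ball_set : clear implicits.

Lemma root_ball_set (G : mgraph) (r : nat) : root G \in ball_set G r.
Proof. by apply/mem_set; case: r => [|r] //=; left. Qed.

(** Marks are those of the ambient graph [G], not recomputed in the ball. *)
Definition nbhd (r : nat) (G : mgraph) : mgraph :=
  {| vertex := set_type (ball_set G r);
     arc u v := arc (val u) (val v);
     mark u := mark (val u);
     root := exist _ (root G) (root_ball_set G r) |}.

(** A random rooted graph [(N, v)] enters local weak convergence only through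
    the numbers [P (U_r(N, v) ~ G)]. *)
Definition nbhd_law (R : realType) := nat -> mgraph -> R.

Definition local_weak_cvg (R : realType)
    (mu : nat -> nbhd_law R) (nu : nbhd_law R) : Prop :=
  forall (r : nat) (G : mgraph), finite_mgraph G ->
    mu n r G @[n --> \oo] --> nu r G.

Definition deterministic_law (R : realType) (L : mgraph) : nbhd_law R :=
  fun r G => (`[< mgraph_iso (nbhd r L) G >]%:R)%R.

(** * Simplex tree-child networks on the label set [n] *)

(** Up to isomorphism the vertex set of a finite network is some ['I_m]. *)
Definition lgraph (n : nat) : Type :=
  {m : nat & ({set 'I_m * 'I_m} * {ffun 'I_n -> 'I_m})%type}.

HB.instance Definition _ n := Choice.copy (lgraph n)
  {m : nat & ({set 'I_m * 'I_m} * {ffun 'I_n -> 'I_m})%type}.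

Section Networks.
Variable n : nat.
Implicit Type g : lgraph n.

Definition vert g : finType := 'I_(tag g).
Definition edge g : rel (vert g) := fun u v => (u, v) \in (tagged g).1.
Definition label g : 'I_n -> vert g := (tagged g).2.

Definition deg g (v : vert g) : nat * nat :=
  (#|[pred u | edge u v]|, #|[pred w | edge v w]|).

Definition is_leaf g (v : vert g) : bool := deg v == (1, 0).
Definition is_tree g (v : vert g) : bool := deg v == (1, 2).
Definition is_ret g (v : vert g) : bool := deg v == (2, 1).

Definition acyclic g : bool :=
  [forall u : vert g, forall v : vert g,
     edge u v ==> ~~ connect (@edge g) v u].

Definition well_rooted g : bool :=
  [exists o : vert g,
    [&& deg o == (0, 1),
        [forall v, connect (@edge g) o v] &
        [forall v, (v != o) ==> [|| is_leaf v, is_tree v | is_ret v]]]].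

Definition well_labelled g : bool :=
  injectiveb (@label g) &&
  [forall v : vert g, (v \in codom (@label g)) == is_leaf v].

Definition tree_child g : bool :=
  [forall u : vert g, ~~ is_leaf u ==>
    [exists v, edge u v && (is_tree v || is_leaf v)]].

Definition one_component g : bool :=
  [forall u : vert g, forall v, is_ret u && edge u v ==> is_leaf v].

Definition simplex_tree_child g : bool :=
  [&& acyclic g, well_rooted g, well_labelled g, tree_child g &
      one_component g].

Definition network : Type := {g : lgraph n | simplex_tree_child g}.

HB.instance Definition _ :=
  Choice.copy network {g : lgraph n | simplex_tree_child g}.

Definition network_iso (N M : network) : Prop :=
  exists f : vert (val N) -> vert (val M),
    [/\ bijective f,
        forall u v, edge (f u) (f v) = edge u v &
        forall i, f (label (val N) i) = label (val M) i].

Lemma network_iso_refl (N : network) : network_iso N N.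
Proof. by exists id; split => //; exists id. Qed.

Lemma network_iso_sym (N M : network) : network_iso N M -> network_iso M N.
Proof.
move=> [f [[h fK hK] fE fl]]; exists h; split; first by exists f.
- by move=> u v; rewrite -fE !hK.
- by move=> i; rewrite -fl fK.
Qed.

Lemma network_iso_trans (N M P : network) :
  network_iso N M -> network_iso M P -> network_iso N P.
Proof.
move=> [f [bf fE fl]] [h [bh hE hl]]; exists (h \o f); split.
- exact: bij_comp.
- by move=> u v /=; rewrite hE fE.
- by move=> i /=; rewrite fl hl.
Qed.

Definition network_isob (N M : network) : bool := `[< network_iso N M >].

Lemma network_isob_refl : reflexive network_isob.
Proof. by move=> N; apply/asboolP/network_iso_refl. Qed.

Lemma network_isob_sym : symmetric network_isob.
Proof.
by move=> N M; apply/asboolP/asboolP => /network_iso_sym.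
Qed.

Lemma network_isob_trans : transitive network_isob.
Proof.
move=> M N P /asboolP NM /asboolP MP.
by apply/asboolP; apply: network_iso_trans NM MP.
Qed.

Canonical network_equiv :=
  EquivRel network_isob network_isob_refl network_isob_sym network_isob_trans.

Definition kind_of g (v : vert g) : kind :=
  if deg v == (0, 1) then RootKind
  else if is_leaf v then LeafKind
  else if is_tree v then TreeKind
  else RetKind.

Definition rooted_at g (v : vert g) : mgraph :=
  {| vertex := vert g; arc := @edge g; mark := @kind_of g; root := v |}.

End Networks.

Notation network_class n := {eq_quot (network_equiv n)}%qT.

Local Open Scope ring_scope.

(** Probability that a uniform leaf [v] of the network [N] satisfies
    [U_r(N, v) ~ G]; it only depends on the isomorphism class of [N]. *)
Definition leaf_freq (R : realType) (n r : nat) (G : mgraph)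
    (N : network n) : R :=
  #|[pred v : vert (val N) |
      is_leaf v && `[< mgraph_iso (nbhd r (rooted_at v)) G >]]|%:R
  / #|[pred v : vert (val N) | is_leaf v]|%:R.

(** The law of [(N_n, w_n)]: [N_n] is uniform on isomorphism classes and, given
    [N_n], [w_n] is uniform on the leaves of [N_n].  There are finitely many
    classes, so neither [fset_set] nor the [\in] sum takes its default value. *)
Definition uniform_leaf_law (R : realType) (n : nat) : nbhd_law R :=
  fun r G =>
    (\sum_(c \in [set: network_class n]) leaf_freq R r G (repr c))
    / #|` fset_set [set: network_class n]|%fset%:R.

(** * The limit network *)

Definition nzint : Type := {i : int | i != 0}.

(** [SpineOf s i] is the spine introduced when decorating the [i]-th vertex of
    [s]; it is indexed so that its vertex [w(x)] has index 0.  Hence, on every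
    spine, exactly the vertices of nonzero index are decorated. *)
Inductive spine :=
| SpineP
| SpineQ
| SpineOf of spine & nzint.

Inductive lim_vertex :=
| SpineV of spine & int
| Rho of spine & nzint
| Ell of spine & nzint
| Rho0
| Ell0.

Inductive lim_arc : lim_vertex -> lim_vertex -> Prop :=
| arc_spine s (i : int) : lim_arc (SpineV s i) (SpineV s (i + 1))
| arc_P_rho0 : lim_arc (SpineV SpineP 0) Rho0
| arc_Q_rho0 : lim_arc (SpineV SpineQ 0) Rho0
| arc_rho0_ell0 : lim_arc Rho0 Ell0
| arc_x_rho s (i : nzint) : lim_arc (SpineV s (val i)) (Rho s i)
| arc_w_rho s (i : nzint) : lim_arc (SpineV (SpineOf s i) 0) (Rho s i)
| arc_rho_ell s (i : nzint) : lim_arc (Rho s i) (Ell s i).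

Definition lim_mark (v : lim_vertex) : kind :=
  match v with
  | SpineV _ _ => TreeKind
  | Rho _ _ | Rho0 => RetKind
  | Ell _ _ | Ell0 => LeafKind
  end.

Definition leaf_limit : mgraph :=
  {| vertex := lim_vertex; arc := lim_arc; mark := lim_mark; root := Ell0 |}.

(* Main.v *)
(** Call a vertex bad if it is the root, a tree vertex without reticulation
    child, a leaf not below a reticulation, or a parent of a reticulation whose
    two parents are joined by a short detour. Around a leaf with no bad vertex
    nearby the network has no short cycle and every vertex looks like one of the
    limit, so the ball is that of the limit. As degrees are at most 3, it
    suffices that the mean number of bad vertices is o(n). Let m be the number
    of leaves not below a reticulation; there are then m - 1 tree vertices
    without reticulation child. Two switchings, reversible up to isomorphism
    and a bounded amount of information, give the bounds.
    - Choose such a leaf x and such a tree vertex b, and move x below a new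
      reticulation with parents b and a new vertex on the old arc to x, which
      takes over a child of b. The position of the new vertex, one of at most 2n
      parents of reticulations, is enough to undo this, so the mean of m (m - 1)
      is at most 2 n.
    - Exchange a parent a of a reticulation having a short detour with a parent
      b of another reticulation. Afterwards a and b are close to each other, so
      only O(n) pairs (a, b) can occur in the result, against about 2 n choices
      of b for each a; hence the mean number of such a is O(1). *)

From HB Require Import structures.
Require Import Defs.
From mathcomp Require Import all_boot all_order all_algebra.
From mathcomp Require Import perm finmap zify.
From mathcomp Require Import all_classical all_reals all_analysis.

Set Implicit Arguments.
Unset Strict Implicit.
Unset Printing Implicit Defensive.

(** * Counting vertices of a simplex network *)

Section SimplexNet.
Variables (n : nat) (V : finType) (e : rel V) (l : 'I_n -> V).
Implicit Types u v w : V.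

Definition vdeg v : nat * nat := (#|[pred u | e u v]|, #|[pred w | e v w]|).
Definition rootv v := vdeg v == (0, 1).
Definition leafv v := vdeg v == (1, 0).
Definition treev v := vdeg v == (1, 2).
Definition retv v := vdeg v == (2, 1).

(** Stated over any finite type, because the switchings produce networks on [V] and on
    [option (option V)]. Acyclicity takes the form of a rank function, which each switching can
    exhibit; [simplex_netP] derives reachability from the root by descending this rank. *)
Record simplex_net : Prop := SimplexNet {
  net_rank : exists h : V -> nat, forall u v, e u v -> h u < h v;
  net_root : exists2 o, rootv o &
    forall v, v != o -> [|| leafv v, treev v | retv v];
  net_label_inj : injective l;
  net_label_leaf : forall v, (v \in codom l) = leafv v;
  net_tree_child : forall u, ~~ leafv u -> exists2 v, e u v & treev v || leafv v;
  net_one_component : forall u v, retv u -> e u v -> leafv v }.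

Definition rchild u := [exists v, e u v && retv v].
Definition bif u := treev u && ~~ rchild u.
Definition tleaf v := leafv v && ~~ [exists u, e u v && retv u].

Lemma card1_eq (P : pred V) x y : #|P| <= 1 -> P x -> P y -> x = y.
Proof. by move=> /card_le1_eqP P1 Px Py; apply: P1. Qed.

Lemma card2_eq (P : pred V) x y z :
  #|P| <= 2 -> P x -> P y -> P z -> x != y -> (z == x) || (z == y).
Proof.
move=> P2 Px Py Pz xy; apply/negP => /negP; rewrite negb_or => /andP[zx zy].
have: #|[:: x; y; z]| <= #|P|.
  by apply/subset_leq_card/fintype.subsetP => t; rewrite !inE => /or3P[] /eqP->.
by rewrite (card_uniqP _) /= ?inE ?negb_or ?xy 1?eq_sym ?zx 1?eq_sym ?zy //; lia.
Qed.

Hypothesis N : simplex_net.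

Lemma net_irr u : e u u = false.
Proof. by case: (net_rank N) => h hP; apply/negP => /hP; rewrite ltnn. Qed.

Lemma net_asym u v : e u v -> e v u = false.
Proof.
case: (net_rank N) => h hP uv; apply/negP => /hP.
by move: (hP _ _ uv) => /ltnW; rewrite leqNgt => /negP.
Qed.

Lemma indeg_gt0 u v : e u v -> 0 < (vdeg v).1.
Proof. by move=> uv; apply/card_gt0P; exists u. Qed.

Lemma outdeg_gt0 u v : e u v -> 0 < (vdeg u).2.
Proof. by move=> uv; apply/card_gt0P; exists v. Qed.

Lemma net_kind v : [|| rootv v, leafv v, treev v | retv v].
Proof.
case: (net_root N) => o ro oP; case: (eqVneq v o) => [->|/oP ->].
  by rewrite ro.
by rewrite orbT.
Qed.

Lemma head_kind u v : e u v -> [|| leafv v, treev v | retv v].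
Proof.
move=> uv; case/orP: (net_kind v) => // /eqP rv.
by move: (indeg_gt0 uv); rewrite rv.
Qed.

Lemma tail_nleaf u v : e u v -> ~~ leafv u.
Proof. by move=> uv; apply/negP => /eqP lu; move: (outdeg_gt0 uv); rewrite lu. Qed.

Lemma parent_uniq u u' v : ~~ retv v -> e u v -> e u' v -> u = u'.
Proof.
move=> rv uv u'v; apply: (@card1_eq [pred u | e u v]) => //=.
by move: (head_kind uv); rewrite (negPf rv) orbF => /orP[] /eqP [] ->.
Qed.

Lemma ret_child_uniq r v v' : retv r -> e r v -> e r v' -> v = v'.
Proof.
move=> /eqP [_ r1] rv rv'.
by apply: (@card1_eq [pred w | e r w]) => //=; rewrite r1.
Qed.

Lemma ret_child r : retv r -> exists2 v, e r v & leafv v.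
Proof.
move=> rr; have [_ r1] := eqP rr.
have /card_gt0P[v /= rv]: 0 < #|[pred w | e r w]| by rewrite r1.
by exists v => //; apply: net_one_component rv.
Qed.

(** The root has a single child, which by tree-child is not a reticulation; by one-component a
    reticulation is not above another. *)
Lemma ret_parent_tree u r : retv r -> e u r -> treev u.
Proof.
move=> rr ur; case/or4P: (net_kind u) => // [/eqP [_ u1]|lu|ru].
- have /(net_tree_child N)[v uv]: ~~ leafv u by apply: tail_nleaf ur.
  rewrite (@card1_eq [pred w | e u w] v r) ?u1 //.
  by rewrite /treev /leafv (eqP rr).
- by move: (tail_nleaf ur); rewrite lu.
- by move: (net_one_component N ru ur); rewrite /leafv (eqP rr).
Qed.

(** A parent of a reticulation has two children, and tree-child reserves one of them for a
    non-reticulation. *)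
Lemma rchild_uniq u r r' : retv r -> retv r' -> e u r -> e u r' -> r = r'.
Proof.
move=> rr rr' ur ur'; case: (eqVneq r r') => // nrr'.
have tu := ret_parent_tree rr ur.
have [v uv] := net_tree_child N (tail_nleaf ur).
have [_ u2] := eqP tu.
have /orP[/eqP->|/eqP->]: (v == r) || (v == r').
- by apply: (@card2_eq [pred w | e u w]) => //=; rewrite u2.
- by rewrite /treev /leafv (eqP rr).
- by rewrite /treev /leafv (eqP rr').
Qed.

Lemma nrchild_uniq u v v' : rchild u -> ~~ retv v -> ~~ retv v' ->
  e u v -> e u v' -> v = v'.
Proof.
move=> /existsP[r /andP[ur rr]] nv nv' uv uv'.
have [_ u2] := eqP (ret_parent_tree rr ur).
have rv : r != v by apply: contraNneq nv => <-.
have /orP[/eqP rE|/eqP //]: (v' == r) || (v' == v).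
- by apply: (@card2_eq [pred w | e u w]) => //=; rewrite u2.
- by move: nv'; rewrite rE rr.
Qed.

Lemma ret_parent_cases r a a' u :
  retv r -> e a r -> e a' r -> a != a' -> e u r -> (u == a) || (u == a').
Proof.
move=> /eqP [r2 _] ar a'r aa' ur.
by apply: (@card2_eq [pred w | e w r]) => //=; rewrite r2.
Qed.

Lemma ret_other_parent r a : retv r -> exists2 a', e a' r & a' != a.
Proof.
move=> /eqP [r2 _].
have /card_gt1P[x [y [xr yr xy]]]: 1 < #|[pred w | e w r]| by rewrite r2.
case: (eqVneq x a) xy => [->|xa] xy; last by exists x.
by exists y; rewrite // eq_sym.
Qed.

Lemma kind_num v : ((vdeg v).1 = leafv v + treev v + (retv v + retv v))%N /\
  ((vdeg v).2 = rootv v + (treev v + treev v) + retv v)%N.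
Proof.
by case/or4P: (net_kind v) => /eqP vE;
  rewrite /leafv /treev /rootv /retv vE.
Qed.

Lemma card_in (P : pred V) u :
  \sum_(v | P v) e v u = #|[pred v | P v && e v u]|.
Proof.
by rewrite -sum1_card big_mkcondr; apply: eq_bigr => v _; case: (e v u).
Qed.

Lemma card_out (P : pred V) u :
  \sum_(v | P v) e u v = #|[pred v | P v && e u v]|.
Proof.
by rewrite -sum1_card big_mkcondr; apply: eq_bigr => v _; case: (e u v).
Qed.

Lemma sum_bool (P : V -> bool) : \sum_v P v = #|P|.
Proof. by rewrite -sum1_card [RHS]big_mkcond; apply: eq_bigr => v _;
  rewrite unfold_in; case: (P v). Qed.

Lemma card_leaf : #|leafv| = n.
Proof.
rewrite -[RHS]card_ord -(card_codom (@net_label_inj N)).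
by apply: eq_card => v; rewrite net_label_leaf.
Qed.

Lemma card_root : #|rootv| = 1.
Proof.
case: (net_root N) => o ro oP; rewrite -(card1 o); apply: eq_card => v.
rewrite !inE; apply/idP/eqP => [rv|->//]; apply/eqP; case: (eqVneq v o) => // /oP.
by rewrite /leafv /treev /retv (eqP rv).
Qed.

(** Handshake: equating total indegree and total outdegree gives n + t + 2r = 1 + 2t + r. *)
Lemma card_tree : #|treev| + 1 = n + #|retv|.
Proof.
have: \sum_v (vdeg v).1 = \sum_v (vdeg v).2.
  under eq_bigr => v _ do rewrite -[(vdeg v).1](@card_in xpredT).
  rewrite exchange_big /=; apply: eq_bigr => v _.
  by rewrite (@card_out xpredT).
under eq_bigr => v _ do rewrite (proj1 (kind_num v)).
under [in RHS]eq_bigr => v _ do rewrite (proj2 (kind_num v)).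
rewrite !big_split /= !(sum_bool leafv, sum_bool treev, sum_bool retv, sum_bool rootv);
  rewrite card_leaf card_root; lia.
Qed.

Lemma card_ret_child u : #|[pred v | retv v && e u v]| = rchild u.
Proof.
case: (boolP (rchild u)) => [/existsP[r /andP[ur rr]]|/existsPn uP]; last first.
  by apply/eq_card0 => r; rewrite !inE andbC; apply/negbTE/uP.
rewrite -[RHS](card1 r); apply: eq_card => r'; rewrite !inE.
by apply/andP/eqP => [[rr' ur']|->//]; apply: rchild_uniq ur' ur.
Qed.

(** Double count of the arcs into reticulations: two per head, at most one per tail. *)
Lemma card_rchild : #|rchild| = 2 * #|retv|.
Proof.
have <-: \sum_(r | retv r) (vdeg r).1 = 2 * #|retv|.
  by rewrite mulnC -sum_nat_const; apply: eq_bigr => r /eqP ->.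
under eq_bigr => v _ do rewrite -[(vdeg v).1](@card_in xpredT).
rewrite exchange_big /= -sum_bool; apply: eq_bigr => u _.
by rewrite card_out card_ret_child.
Qed.

(** Double count of the arcs out of reticulations: one per tail, and each ends in a leaf, which has
    no other parent. *)
Lemma card_tleaf : #|tleaf| + #|retv| = n.
Proof.
have <-: \sum_(r | retv r) (vdeg r).2 = #|retv|.
  by rewrite -sum1_card; apply: eq_bigr => r /eqP ->.
under eq_bigr => v _ do rewrite -[(vdeg v).2](@card_out xpredT).
rewrite exchange_big /= -[RHS]card_leaf -(sum_bool tleaf) -(sum_bool leafv) -big_split /=.
apply: eq_bigr => v _; rewrite card_in /tleaf.
case: (boolP [exists u, _]) => [/existsP[u /andP[uv ru]]|/existsPn vP].
  rewrite (net_one_component N ru uv) /= add0n -(card1 u); apply: eq_card => u'.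
  rewrite !inE; apply/andP/eqP => [[ru' u'v]|->//]; apply: (parent_uniq _ u'v uv).
  by rewrite /retv (eqP (net_one_component N ru uv)).
rewrite eq_card0 ?addn0 ?andbT // => u; rewrite !inE andbC; exact/negbTE/vP.
Qed.

(** Of the n + r - 1 tree vertices 2r have a reticulation child, which leaves n - r - 1. *)
Lemma card_bif : #|bif| + 1 = #|tleaf|.
Proof.
have := card_tleaf; have := card_rchild; have := card_tree.
suff -> : #|treev| = #|bif| + #|rchild| by lia.
rewrite -(sum_bool treev) -(sum_bool bif) -(sum_bool rchild) -big_split /=;
  apply: eq_bigr => u _; rewrite /bif.
case: (boolP (rchild u)) => [/existsP[r /andP[ur rr]]|_]; last by rewrite andbT addn0.
by rewrite (ret_parent_tree rr ur).
Qed.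

Lemma card_net : #|V| <= 4 * n.
Proof.
have: #|V| = #|rootv| + #|leafv| + #|treev| + #|retv|.
  rewrite -sum1_card -(sum_bool rootv) -(sum_bool leafv) -(sum_bool treev).
  rewrite -(sum_bool retv) -!big_split /=; apply: eq_bigr => v _.
  by case/or4P: (net_kind v) => /eqP vE; rewrite /leafv /treev /rootv /retv vE.
by rewrite card_root card_leaf; move: card_tree card_tleaf; lia.
Qed.

End SimplexNet.

(** * Isomorphisms, rigidity and transport to [network] *)

Lemma connect_homo (V : finType) (e : rel V) (h : V -> nat) u v :
  (forall x y, e x y -> h x < h y) -> connect e u v -> h u <= h v.
Proof.
move=> he /connectP[p + ->]; elim: p u => //= x p IH u /andP[/he ux /IH].
exact/leq_trans/ltnW.
Qed.

Lemma connect_asym (V : finType) (e : rel V) (h : V -> nat) u v :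
  (forall x y, e x y -> h x < h y) -> e u v -> ~~ connect e v u.
Proof.
move=> he uv; apply/negP => /(connect_homo he).
by rewrite leqNgt he.
Qed.

Section Isomorphism.
Variables (n : nat) (V1 V2 : finType) (e1 : rel V1) (e2 : rel V2).
Variables (l1 : 'I_n -> V1) (l2 : 'I_n -> V2) (f : V1 -> V2).
Hypotheses (fB : bijective f) (fE : forall u v, e2 (f u) (f v) = e1 u v).

Lemma card_bij (P1 : pred V1) (P2 : pred V2) :
  (forall u, P2 (f u) = P1 u) -> #|P2| = #|P1|.
Proof.
move=> P12; rewrite -!sum1_card (reindex f) /=; last exact: onW_bij.
by apply: eq_bigl => u; rewrite unfold_in P12.
Qed.

Lemma iso_vdeg v : vdeg e2 (f v) = vdeg e1 v.
Proof. by congr (_, _); apply: card_bij => u /=; rewrite fE. Qed.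

Hypothesis fl : forall i, f (l1 i) = l2 i.

Lemma iso_simplex_net : simplex_net e1 l1 -> simplex_net e2 l2.
Proof.
case: fB => g fK gK [[h hP] [rt ro oP] linj lP tc oc].
have gE u v : e1 (g u) (g v) = e2 u v by rewrite -fE !gK.
have gdeg v : vdeg e1 (g v) = vdeg e2 v by rewrite -iso_vdeg gK.
have kE P v : (vdeg e2 v == P) = (vdeg e1 (g v) == P) by rewrite gdeg.
split.
- by exists (h \o g) => u v; rewrite -gE => /hP.
- exists (f rt); first by rewrite /rootv kE fK.
  move=> v vo; have := oP (g v); rewrite /leafv /treev /retv !kE; apply.
  by apply: contraNneq vo => <-; rewrite gK.
- by move=> i j; rewrite -!fl => /(can_inj fK) /linj.
- move=> v; rewrite /leafv kE -[RHS]lP; apply/codomP/codomP => -[i vE]; exists i.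
    by rewrite vE -fl fK.
  by rewrite -fl -vE gK.
- move=> u; rewrite /leafv kE => /tc [v uv kv]; exists (f v).
    by rewrite -gE fK.
  by rewrite /treev !kE fK.
- by move=> u v; rewrite /retv /leafv !kE -gE; apply: oc.
Qed.

End Isomorphism.

(* Every non-leaf has a child of indegree 1, which determines it. *)
Lemma net_rigid n (V : finType) (e : rel V) (l : 'I_n -> V) (f : V -> V) :
  simplex_net e l -> (forall u v, e (f u) (f v) = e u v) ->
  (forall i, f (l i) = l i) -> f =1 id.
Proof.
move=> N fE fl v; case: (net_rank N) => h hP.
(* Induction on the rank downwards from its maximum, so that children are settled before their
   parents. *)
have [k] := ubnP (\max_u h u - h v); elim: k v => // k IH v vk.
have [lv|nlv] := boolP (leafv e v).
  by move: lv; rewrite -(net_label_leaf N) => /codomP[i ->].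
have [c vc kc] := net_tree_child N nlv.
have fc : f c = c.
  by apply: IH; move: (hP _ _ vc) (@leq_bigmax _ h c) (@leq_bigmax _ h v); lia.
apply: (@parent_uniq _ _ _ _ N _ _ c) => //.
  by apply/negP => /eqP; case/orP: kc => /eqP ->.
by rewrite -{1}fc fE.
Qed.

Lemma simplex_netP n (g : lgraph n) :
  simplex_tree_child g <-> simplex_net (@edge n g) (@label n g).
Proof.
split=> [/and5P[ac wr /andP[li ll] tc oc]|N].
  split.
  (* The number of ancestors is a rank: by acyclicity it increases strictly along arcs. *)
  - exists (fun v => #|[pred u | connect (@edge n g) u v]|) => u v uv.
    apply/proper_card/properP; split.
      apply/fintype.subsetP => w; rewrite !inE => wu.
      exact: connect_trans wu (connect1 uv).
    exists v; rewrite !inE ?connect0 //.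
    by move/forallP/(_ u)/forallP/(_ v)/implyP: ac; apply.
  - case/existsP: wr => o /and3P[ro _ /forallP oP]; exists o => // v vo.
    by move: (oP v); rewrite vo.
  - exact/injectiveP.
  - by move=> v; move/forallP/(_ v)/eqP: ll.
  - move=> u nlu; move/forallP/(_ u): tc; rewrite nlu => /existsP[v /andP[uv kv]].
    by exists v.
  - move=> u v ru uv; move/forallP/(_ u)/forallP/(_ v)/implyP: oc; apply.
    exact/andP.
have [h hP] := net_rank N.
apply/and5P; split.
- apply/forallP => u; apply/forallP => v; apply/implyP => uv.
  exact: connect_asym hP uv.
- have [rt ro oP] := net_root N.
  apply/existsP; exists rt; apply/and3P; split => //; apply/forallP => v; last first.
    by apply/implyP => /oP.
  (* Climbing to a parent lowers the rank and can stop only at the root, the one vertex of indegree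
     0. *)
  have [k] := ubnP (h v); elim: k v => // k IH v vk.
  have [->|/oP kv] := eqVneq v rt; first exact: connect0.
  have /card_gt0P[u uv] : 0 < #|[pred u | edge u v]|.
    by move: kv => /or3P[] /eqP[-> _].
  apply: connect_trans (connect1 uv); apply: IH.
  exact: leq_trans (hP _ _ uv) _.
- apply/andP; split; first by apply/injectiveP; apply: net_label_inj N.
  by apply/forallP => v; apply/eqP; apply: (net_label_leaf N).
- apply/forallP => u; apply/implyP => /(net_tree_child N) [v uv kv].
  by apply/existsP; exists v; rewrite uv.
- apply/forallP => u; apply/forallP => v; apply/implyP => /andP[ru uv].
  exact: (net_one_component N ru uv).
Qed.

Definition iso_map n (N M : network n) (f : vert (val N) -> vert (val M)) :=
  [/\ bijective f, forall u v, edge (f u) (f v) = edge u v &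
      forall i, f (label (val N) i) = label (val M) i].

Lemma network_net n (N : network n) :
  simplex_net (@edge n (val N)) (@label n (val N)).
Proof. exact/simplex_netP/(valP N). Qed.

(** A [network] lives on an ordinal; numbering the vertices brings the result of a switching back to
    that form. *)
Lemma realize n (V : finType) (e : rel V) (l : 'I_n -> V) :
  simplex_net e l -> exists (M : network n) (d : V -> vert (val M)),
  [/\ bijective d, forall u v, edge (d u) (d v) = e u v &
      forall i, d (l i) = label (val M) i].
Proof.
move=> N.
pose g : lgraph n := existT _ #|V|
  ([set p : 'I_#|V| * 'I_#|V| | e (enum_val p.1) (enum_val p.2)]%SET,
   [ffun i => enum_rank (l i)]).
have dE u v : @edge n g (enum_rank u) (enum_rank v) = e u v.
  by rewrite /edge inE /= !enum_rankK.
have dl i : enum_rank (l i) = label g i by rewrite /label ffunE.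
have gN : simplex_tree_child g.
  apply/simplex_netP; apply: (iso_simplex_net _ dE dl) N.
  exact: enum_rank_bij.
exists (exist _ g gN : network n), (@enum_rank V); split => //.
Qed.

Lemma card_orP (V : finType) (P Q : V -> bool) :
  #|[pred x | P x || Q x]| <= #|P| + #|Q|.
Proof. by rewrite -(cardUI P Q) leq_addr. Qed.

Lemma card_bigcup_le (T : finType) (P : T -> bool) (F : T -> T -> bool) k :
  (forall x, P x -> #|F x| <= k) ->
  #|[pred v | [exists x, P x && F x v]]| <= #|P| * k.
Proof.
move=> Fk; rewrite -sum_nat_const.
apply: (@leq_trans (\sum_(x in P) #|F x|)); last exact: leq_sum.
apply: (@leq_trans #|\bigcup_(x in P) [set v | F x v]%SET|).
  apply/subset_leq_card/fintype.subsetP => v; rewrite inE => /existsP[x /andP[Px xv]].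
  by apply/bigcupP; exists x; rewrite ?inE.
elim/big_ind2: _ => [|i A j B Ai Bj|x _]; rewrite ?cards0 //.
  by rewrite (leq_trans (leq_card_setU A B)) ?leq_add.
by rewrite cardsE.
Qed.

(** * Undirected distance and growth of balls *)

Section Near.
Variables (V : finType) (e : rel V).

Definition adj u v := e u v || e v u.

Lemma adjC u v : adj u v = adj v u.
Proof. by rewrite /adj orbC. Qed.

Fixpoint nearby k u v :=
  if k is k'.+1 then (u == v) || [exists x, adj u x && nearby k' x v] else u == v.

Lemma nearby_refl k u : nearby k u u.
Proof. by case: k => [|k] /=; rewrite eqxx. Qed.

Lemma nearbyS k u v : nearby k u v -> nearby k.+1 u v.
Proof.
elim: k u => [|k IH] u /=; first by move->.
case/orP => [->//|/existsP[x /andP[ux /IH xv]]].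
by apply/orP; right; apply/existsP; exists x; rewrite ux.
Qed.

Lemma nearby_leq j k u v : j <= k -> nearby j u v -> nearby k u v.
Proof.
move=> jk; rewrite -(subnK jk); elim: (k - j) => // i IH /IH.
exact: nearbyS.
Qed.

Lemma nearby_adj u v : adj u v -> nearby 1 u v.
Proof.
move=> uv; apply/orP; right; apply/existsP; exists v.
by rewrite uv /=.
Qed.

Lemma nearby_trans j k u v w : nearby j u v -> nearby k v w -> nearby (j + k) u w.
Proof.
elim: j u => [|j IH] u /=; first by move/eqP->.
case/orP => [/eqP ->|/existsP[x /andP[ux /IH xv]]] vw.
  by apply: (@nearby_leq k (j + k).+1) vw; lia.
by apply/orP; right; apply/existsP; exists x; rewrite ux /=; apply: xv.
Qed.

Lemma nearby_sym k u v : nearby k u v -> nearby k v u.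
Proof.
elim: k u => [|k IH] u /=; first by rewrite eq_sym.
case/orP => [/eqP ->|/existsP[x /andP[ux /IH xv]]]; first by rewrite eqxx.
have := @nearby_trans k 1 v x u xv (nearby_adj _); rewrite addn1; apply.
by rewrite adjC.
Qed.

Lemma nearby_path k u p : path adj u p -> size p <= k -> nearby k u (last u p).
Proof.
elim: p k u => [|x p IH] [|k] u //= ; rewrite ?eqxx // => /andP[ux xp] pk.
by apply/orP; right; apply/existsP; exists x; rewrite ux /=; apply: IH.
Qed.

Hypothesis deg3 : forall v, (vdeg e v).1 + (vdeg e v).2 <= 3.

(** With degrees at most 3, the bound follows from 1 + 3 * 4^k <= 4^(k+1). *)
Lemma card_nearby k u : #|[pred v | nearby k u v]| <= 4 ^ k.
Proof.
elim: k u => [|k IH] u.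
  apply: (@leq_trans #|pred1 u|); last by rewrite card1.
  by apply/subset_leq_card/fintype.subsetP => v; rewrite !inE => /eqP ->.
apply: leq_trans (card_orP (eq_op u) _) _.
have u1 : #|eq_op u| = 1 by rewrite -[RHS](card1 u); apply: eq_card => v;
  rewrite !inE eq_sym.
have sphere := @card_bigcup_le _ (adj u) (nearby k) (4 ^ k) (fun x _ => IH x).
have degu : #|adj u| <= 3.
  apply: leq_trans (deg3 u); rewrite addnC; exact: card_orP.
apply: leq_trans (leq_add (eq_leq u1) sphere) _.
have : 0 < 4 ^ k by rewrite expn_gt0.
by rewrite expnS; nia.
Qed.

End Near.

(** Pigeonhole with a relation in place of an injection: one [x] may have several partners, but a
    partner determines its [x]. The induction removes a used partner from [t]. *)
Lemma size_le_rel (A B : eqType) (s : seq A) (t : seq B) (T : A -> B -> Prop) :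
  uniq s -> (forall x, x \in s -> exists2 y, y \in t & T x y) ->
  (forall x x' y, T x y -> T x' y -> x = x') -> size s <= size t.
Proof.
move=> + + Tinj; elim: s t => //= x s IH t /andP[xs us] sT.
have [y yt Txy] := sT x (mem_head _ _).
have t0 : 0 < size t by case: t yt {sT}.
apply: (@leq_ltn_trans (size t).-1); last by rewrite prednK.
rewrite -(size_rem yt); apply: IH => // x' x's.
have [|y' y't Txy'] := sT x'; first by rewrite inE x's orbT.
exists y' => //; case: (eqVneq y' y) => [yE|yy'].
  by move: Txy' xs; rewrite yE => /(Tinj _ _ _ Txy) ->; rewrite x's.
exact: rem_mem.
Qed.

(** * Double counting over isomorphism classes *)

Section Classes.
Variable n : nat.
Local Notation classes := (fset_set [set: network_class n]%classic).

Lemma repr_iso (N : network n) :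
  exists f : vert (val N) -> vert (val (repr (\pi_(network_class n)%qT N))), iso_map f.
Proof.
have : network_isob N (repr (\pi_(network_class n)%qT N)).
  have := reprK (\pi_(network_class n)%qT N); move/eqquotP; rewrite network_isob_sym.
  by [].
by move/asboolP.
Qed.

Lemma iso_repr_eq (c c' : network_class n)
    (f : vert (val (repr c)) -> vert (val (repr c'))) : iso_map f -> c = c'.
Proof.
move=> fI; rewrite -[c]reprK -[c']reprK; apply/eqquotP/asboolP.
by exists f.
Qed.

Lemma iso_map_id (N : network n) (f : vert (val N) -> vert (val N)) :
  iso_map f -> f =1 id.
Proof. by case=> _ fE fl; apply: net_rigid (network_net N) fE fl. Qed.

(** A network has at most 4n vertices, so the representatives embed in a finite sum of finite
    types. *)
Lemma finite_classes : finite_set [set: network_class n]%classic.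
Proof.
have cardN (N : network n) : tag (val N) < (4 * n).+1.
  by rewrite ltnS -[tag _]card_ord; apply: card_net (network_net N).
pose F := {m : 'I_(4 * n).+1 & ({set 'I_m * 'I_m} * {ffun 'I_n -> 'I_m})%type}.
pose f (c : network_class n) : F := 
  existT (fun m : 'I_(4 * n).+1 => ({set 'I_m * 'I_m} * {ffun 'I_n -> 'I_m})%type)
    (Ordinal (cardN (repr c))) (tagged (val (repr c))).
pose g (x : F) : lgraph n := existT _ (val (tag x)) (tagged x).
have gf c : g (f c) = val (repr c) by rewrite /g /f /=; case: (val (repr c)).
have fI : injective f by move=> c c' /(congr1 g);
  rewrite !gf => /val_inj /(can_inj (@reprK _ _)).
rewrite -(preimage_setT f); apply: finite_preimage; first exact: in2W.
exact: finite_finset.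
Qed.

Lemma mem_classes (c : network_class n) : c \in classes.
Proof. by rewrite in_fset_set ?inE //; exact: finite_classes. Qed.

(* [T N M a b c d]: the switching of [N] at the pair [(a, b)] results in [M],
   where it leaves the trace [(c, d)], from which it can be undone. *)
Lemma sum_card_pairs_le (X Y : forall N : network n, rel (vert (val N)))
    (T : forall N M : network n, vert (val N) -> vert (val N) ->
         vert (val M) -> vert (val M) -> Prop) :
  (forall N M f a b, @iso_map n N M f -> Y N a b -> Y M (f a) (f b)) ->
  (forall N a b, X N a b -> exists M c d, T N M a b c d /\ Y M c d) ->
  (forall N1 N2 M1 M2 a1 b1 a2 b2 c1 d1 c2 d2 g,
     T N1 M1 a1 b1 c1 d1 -> T N2 M2 a2 b2 c2 d2 ->
     iso_map g -> g c1 = c2 -> g d1 = d2 ->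
     exists f, [/\ @iso_map n N1 N2 f, f a1 = a2 & f b1 = b2]) ->
  \sum_(c <- classes) #|[pred p | X (repr c) p.1 p.2]| <=
  \sum_(c <- classes) #|[pred p | Y (repr c) p.1 p.2]|.
Proof.
move=> Yiso XT Tinj.
pose W := {c : network_class n & (vert (val (repr c)) * vert (val (repr c)))%type}.
pose pairs (Z : forall N : network n, rel (vert (val N))) : seq W :=
  [seq Tagged (fun c => (vert (val (repr c)) * vert (val (repr c)))%type) p
  | c <- classes, p <- enum [pred p | Z (repr c) p.1 p.2]].
have size_pairs Z : size (pairs Z) =
    \sum_(c <- classes) #|[pred p | Z (repr c) p.1 p.2]|.
  rewrite size_allpairs_dep sumnE big_map; apply: eq_bigr => c _.
  by rewrite cardE.
have mem_pairs Z (x : W) :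
    (x \in pairs Z) = Z (repr (tag x)) (tagged x).1 (tagged x).2.
  apply/allpairsPdep/idP => [[c [p [_ + ->]]]|Zx]; first by rewrite mem_enum inE.
  exists (tag x), (tagged x); split; first exact: mem_classes.
    by rewrite mem_enum inE.
  by case: (x).
rewrite -!size_pairs.
(* The result [M] of a switching need not be the representative of its class, so its trace is
   carried there by some isomorphism [f]. *)
pose Q (x y : W) := exists M c d (f : vert (val M) -> vert (val (repr (tag y)))),
  [/\ T (repr (tag x)) M (tagged x).1 (tagged x).2 c d, iso_map f,
      f c = (tagged y).1 & f d = (tagged y).2].
apply: (@size_le_rel _ _ _ _ Q).
- apply: allpairs_uniq_dep; first exact: fset_uniq.
    by move=> c _; apply: enum_uniq.
  by move=> [c p] [c' p'] _ _ /=.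
- move=> x; rewrite mem_pairs => /XT[M [c [d [Tx Ycd]]]].
  have [f fI] := repr_iso M.
  exists (Tagged (fun c => (vert (val (repr c)) * vert (val (repr c)))%type) (f c, f d)).
    by rewrite mem_pairs /=; apply: Yiso.
  by exists M, c, d, f.
move=> [c [a b]] [c' [a' b']] [k [u v]] [M [p [q [f [/= T1 fI fp fq]]]]].
move=> [M' [p' [q' [f' [/= T2 fI' fp' fq']]]]].
have [[g' gK' Kg'] f'E f'l] := fI'; have [fB fE fl] := fI.
have [|||h [hI ha hb]] := Tinj _ _ _ _ _ _ _ _ _ _ _ _ (g' \o f) T1 T2.
- split; first by apply: bij_comp => //; exists f'.
    by move=> x y /=; rewrite -f'E !Kg' fE.
  by move=> i /=; rewrite fl -f'l gK'.
- by rewrite /= fp -fp' gK'.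
- by rewrite /= fq -fq' gK'.
(* Isomorphic representatives are equal, and by rigidity the isomorphism is then the identity, so
   the two pairs coincide. *)
have cc' := iso_repr_eq hI; subst c'.
by rewrite -ha -hb !(iso_map_id hI).
Qed.

End Classes.

Lemma card_pairs (V : finType) (X : rel V) :
  #|[pred p | X p.1 p.2]| = \sum_a #|[pred b | X a b]|.
Proof.
transitivity (\sum_a \sum_b (X a b : nat)).
  rewrite pair_bigA -sum1_card big_mkcond; apply: eq_bigr => p _ /=.
  by rewrite inE; case: (X _ _).
by apply: eq_bigr => a _; apply: sum_bool.
Qed.

Definition realizes n (M : network n) (V : finType) (e : rel V) (l : 'I_n -> V)
    (d : V -> vert (val M)) :=
  [/\ bijective d, forall u v, edge (d u) (d v) = e u v &
      forall i, d (l i) = label (val M) i].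

Lemma realizes_iso n (M1 M2 : network n) (V1 V2 : finType) e1 e2 l1 l2
    (d1 : V1 -> _) (d2 : V2 -> _) (g : vert (val M1) -> vert (val M2)) :
  realizes e1 l1 d1 -> realizes e2 l2 d2 -> iso_map g ->
  exists f : V1 -> V2, [/\ bijective f, forall u v, e2 (f u) (f v) = e1 u v,
    forall i, f (l1 i) = l2 i & forall u, d2 (f u) = g (d1 u)].
Proof.
move=> [d1B d1E d1l] [[h2 dK hK] d2E d2l] [gB gE gl].
exists (h2 \o g \o d1); split=> [|u v|i|u] /=.
- by apply: bij_comp d1B; apply: bij_comp gB; exists d2.
- by rewrite -d2E !hK gE d1E.
- by rewrite d1l gl -d2l dK.
- by rewrite hK.
Qed.

(** * Exchanging parents of reticulations *)

(** The tails of all arcs into reticulations are transposed. When [a] and [b] have one reticulation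
    child each, this changes only those two arcs; in this form the exchange is undone by the same
    transposition. *)
Definition swap_edge (V : finType) (e : rel V) (a b : V) : rel V :=
  fun u v => if retv e v then e (tperm a b u) v else e u v.

Section Swap.
Variables (n : nat) (V : finType) (e : rel V) (l : 'I_n -> V).
Hypothesis N : simplex_net e l.
Variables a b r r2 : V.
Hypotheses (rr : retv e r) (rr2 : retv e r2) (nrr2 : r != r2).
Hypotheses (ar : e a r) (br2 : e b r2).
Local Notation e' := (swap_edge e a b).

Lemma swap_edgeE u v : ~~ retv e v -> e' u v = e u v.
Proof. by rewrite /swap_edge => /negbTE ->. Qed.

Lemma swap_tree_parent v u : retv e v -> e' u v -> treev e u.
Proof.
move=> rv; rewrite /swap_edge rv => uv; case: tpermP uv => [->|->|_ _] uv.
- exact: (ret_parent_tree N rr ar).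
- exact: (ret_parent_tree N rr2 br2).
- exact: (ret_parent_tree N rv uv).
Qed.

(** Indegrees persist because a transposition permutes the tails. Outdegrees persist because [a] and
    [b] both have exactly one reticulation child and other children are untouched. *)
Lemma swap_vdeg v : vdeg e' v = vdeg e v.
Proof.
congr (_, _).
  rewrite /swap_edge; case: (retv e v) => //.
  apply/esym; apply: (@card_bij V V (tperm a b)) => //.
  by exists (tperm a b); apply: tpermK.
have split_card (f : rel V) u :
    #|[pred w | f u w]| = #|[pred w | ~~ retv e w && f u w]| +
                          #|[pred w | retv e w && f u w]|.
  rewrite -!sum1_card [LHS](bigID (retv e)) addnC; congr addn.
    by apply: eq_bigl => w; rewrite !inE andbC.
  by apply: eq_bigl => w; rewrite !inE andbC.
rewrite !split_card; congr addn.
  by apply: eq_card => w; rewrite !inE; case: (boolP (retv e w)) => // /swap_edgeE ->.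
rewrite (card_ret_child N).
transitivity (rchild e (tperm a b v) : nat).
  rewrite -(card_ret_child N); apply: eq_card => w; rewrite !inE /swap_edge.
  by case: (retv e w).
have ra : rchild e a by apply/existsP; exists r; rewrite ar rr.
have rb : rchild e b by apply/existsP; exists r2; rewrite br2 rr2.
by case: tpermP => // ->; rewrite ra rb.
Qed.

Lemma swap_kind p v : (vdeg e' v == p) = (vdeg e v == p).
Proof. by rewrite swap_vdeg. Qed.

Lemma swap_net : simplex_net e' l.
Proof.
have [h hP] := net_rank N.
have [rt rtP oP] := net_root N.
pose H := (\max_v h v).+1.
have hH v : h v < H by rewrite ltnS; apply: leq_bigmax.
split.
(* Every arc into a reticulation still starts at a tree vertex. Placing reticulations above all tree
   vertices, and leaves above reticulations, therefore gives a rank whatever the exchange did. *)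
- exists (fun v => if leafv e v then H.+1 else if retv e v then H else h v) => u v.
  have [rv uv|nrv] := boolP (retv e v).
    have /eqP := swap_tree_parent rv uv.
    by rewrite /leafv /retv => ->; rewrite (eqP rv) /= hH.
  rewrite swap_edgeE // => uv; rewrite (negPf (tail_nleaf uv)).
  have [lv|nlv] := boolP (leafv e v); first by case: (retv e u);
    rewrite ?leqnn // ltnW // ltnS.
  rewrite ifN ?hP //; apply: contra nlv => ru; exact: (net_one_component N ru uv).
- by exists rt; rewrite /rootv /leafv /treev /retv ?swap_kind // => v;
    rewrite !swap_kind; apply: oP.
- exact: net_label_inj N.
- by move=> v; rewrite /leafv swap_kind; apply: net_label_leaf N v.
- move=> u; rewrite /leafv swap_kind => /(net_tree_child N)[v uv kv]; exists v.
    by rewrite swap_edgeE //; apply/negP => /eqP rv; move: kv; rewrite /treev /leafv rv.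
  by rewrite /treev !swap_kind.
- move=> u v; rewrite /retv /leafv !swap_kind => ru.
  have [rv uv|nrv] := boolP (retv e v).
    by have := swap_tree_parent rv uv; rewrite /treev (eqP ru).
  by rewrite swap_edgeE //; apply: net_one_component N _ _ ru.
Qed.

Lemma swap_keep u v : v != r -> v != r2 -> e u v -> e' u v.
Proof.
move=> vr vr2; rewrite /swap_edge; case: (boolP (retv e v)) => // rv uv.
case: tpermP uv => // -> uv.
  by move: vr; rewrite (rchild_uniq N rv rr uv ar) eqxx.
by move: vr2; rewrite (rchild_uniq N rv rr2 uv br2) eqxx.
Qed.

Lemma swap_path x p : r \notin x :: p -> r2 \notin x :: p ->
  path (adj e) x p -> path (adj e') x p.
Proof.
elim: p x => //= y p IH x; rewrite !inE !negb_or.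
move=> /and3P[rx ry rp] /and3P[r2x r2y r2p] /andP[xy yp].
apply/andP; split; last by apply: IH; rewrite ?inE ?negb_or ?ry ?r2y.
by case/orP: xy => xy; apply/orP; [left|right]; apply: swap_keep; rewrite // eq_sym.
Qed.

(** After the exchange [b] is a parent of [r] beside [a']. The detour avoids [r] and [r2], so it
    survives, and [b], [r], [a'] followed by the detour back to [a] is a walk of length at most L +
    2. *)
Lemma swap_nearby L a' p : e a' r -> a' != a -> path (adj e) a p -> last a p = a' ->
  size p <= L -> r \notin a :: p -> r2 \notin a :: p -> nearby e' L.+2 b a.
Proof.
move=> a'r a'a ap pE pL rp r2p.
have near_a : nearby e' L a' a.
  by apply: nearby_sym; rewrite -pE; apply: nearby_path => //; apply: swap_path.
have ba' : b != a'.
  by apply: contraNneq nrr2 => bE; rewrite (rchild_uniq N rr rr2 a'r) // -bE.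
apply: (@nearby_trans _ _ 1 L.+1 _ r).
  by apply: nearby_adj; rewrite /adj /swap_edge rr tpermR ar.
apply: (@nearby_trans _ _ 1 L _ a') near_a.
by apply: nearby_adj; rewrite /adj orbC /swap_edge rr tpermD ?a'r // eq_sym.
Qed.

End Swap.

(** * Counting the exchanges at short detours *)

Section ShortReticulation.
Variables (V : finType) (e : rel V) (L : nat).

Definition detour (a r a' : V) (p : seq V) :=
  [/\ retv e r /\ e a r, e a' r /\ a' != a, path (adj e) a p, last a p = a' &
      size p <= L /\ r \notin a :: p].

Definition short_parent a : bool := `[< exists r a' p, detour a r a' p >].

Definition swappable a b : bool :=
  `[< exists r r2 a' p, [/\ detour a r a' p, retv e r2, r != r2, e b r2 &
        r2 \notin a :: p] >].

(** By [card_rchild] there are 2r candidates for [b]. Those excluded have a reticulation child among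
    [r] and the at most L + 1 vertices of the detour, hence at most two for each of L + 2
    vertices. *)
Lemma card_swappable n (l : 'I_n -> V) : simplex_net e l ->
  #|short_parent| * (2 * #|retv e| - 2 * L.+2) <=
  #|[pred p | swappable p.1 p.2]|.
Proof.
move=> N; rewrite card_pairs -sum_nat_const.
apply: (@leq_trans (\sum_(a in short_parent) #|[pred b | swappable a b]|)); last first.
  by rewrite [leqRHS](bigID (mem short_parent)) leq_addr.
apply: leq_sum => a /asboolP[r [a' [p dp]]].
have [[rr ar] [a'r a'a] _ _ [pL _]] := dp.
rewrite leq_subLR -(card_rchild N).
pose bad s b := has (fun v => retv e v && e b v) s.
have card_bad s : #|bad s| <= 2 * size s.
  elim: s => [|v s IH]; first by rewrite leqn0; apply/eqP/eq_card0.
  apply: (leq_trans (card_orP _ _)); rewrite mulnS; apply: leq_add IH.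
  have [rv|_] := boolP (retv e v); last by rewrite eq_card0.
  by move: (eqP rv) => [<- _].
apply: (@leq_trans (#|bad (r :: a :: p)| + #|[pred b | swappable a b]|)).
  apply: leq_trans (card_orP _ _).
  apply/subset_leq_card/fintype.subsetP => b /existsP[r2 /andP[br2 rr2]].
  rewrite inE; case: (boolP (bad _ b)) => //= nbad.
  have : r2 \notin r :: a :: p.
    apply: contra nbad => r2p; apply: (introT (@seq.hasP _ _ (r :: a :: p)));
      exists r2 => //.
    by rewrite rr2 br2.
  rewrite inE negb_or => /andP[r2r r2p].
  by apply/asboolP; exists r, r2, a', p; split; rewrite // eq_sym.
rewrite leq_add2r; apply: leq_trans (card_bad _) _.
by rewrite leq_mul2l /= !ltnS.
Qed.

End ShortReticulation.

Lemma iso_nearby (V1 V2 : finType) (e1 : rel V1) (e2 : rel V2) (f : V1 -> V2) k u v :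
  (forall u v, e2 (f u) (f v) = e1 u v) -> nearby e1 k u v -> nearby e2 k (f u) (f v).
Proof.
move=> fE; elim: k u => [|k IH] u /=; first by move/eqP->.
case/orP => [/eqP->|/existsP[x /andP[ux xv]]]; first by rewrite eqxx.
by apply/orP; right; apply/existsP; exists (f x); rewrite /adj !fE IH // andbT.
Qed.

Lemma net_deg3 n (V : finType) (e : rel V) (l : 'I_n -> V) :
  simplex_net e l -> forall v, (vdeg e v).1 + (vdeg e v).2 <= 3.
Proof. by move=> N v; case/or4P: (net_kind N v) => /eqP ->. Qed.

(** The trace of an exchange is the pair of images of [a] and [b], at distance at most L + 2 in the
    result. A network has at most 4n * 4^(L+2) such pairs. *)
Lemma sum_short_parent n L (C := fset_set [set: network_class n]%classic) :
  \sum_(c <- C) #|short_parent (@edge n (val (repr c))) L| *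
    (2 * #|retv (@edge n (val (repr c)))| - 2 * L.+2) <=
  #|` C|%fset * (4 * n * 4 ^ L.+2).
Proof.
pose X (N : network n) := swappable (@edge n (val N)) L.
pose Y (N : network n) := nearby (@edge n (val N)) L.+2.
pose T (N M : network n) (a b : vert (val N)) (c d : vert (val M)) :=
  exists r r2 f, [/\ [/\ retv (@edge n (val N)) r, retv (@edge n (val N)) r2,
    r != r2, edge a r & edge b r2],
    realizes (swap_edge (@edge n (val N)) a b) (@label n (val N)) f, f a = c & f b = d].
have XY : \sum_(c <- C) #|[pred p | X (repr c) p.1 p.2]| <=
          \sum_(c <- C) #|[pred p | Y (repr c) p.1 p.2]|.
  apply: (@sum_card_pairs_le n X Y T).
  - by move=> N M f a b [_ fE _]; apply: iso_nearby.
  - move=> N a b /asboolP[r [r2 [a' [p [dp rr2 nrr2 br2 r2p]]]]].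
    have [[rr ar] [a'r a'a] pp pE [pL rp]] := dp.
    have sN := swap_net (network_net N) rr rr2 ar br2.
    have [M [f [fB fE fl]]] := realize sN.
    exists M, (f a), (f b); split; first by exists r, r2, f.
    apply: iso_nearby fE _; apply: nearby_sym.
    exact: (swap_nearby (network_net N) rr rr2 nrr2 ar br2 a'r a'a pp pE pL rp r2p).
  - move=> N1 N2 M1 M2 a1 b1 a2 b2 c1 d1 c2 d2 g.
    move=> [r1 [s1 [f1 [[rr1 rs1 _ ar1 bs1] f1R f1a f1b]]]].
    move=> [r2 [s2 [f2 [[rr2 rs2 _ ar2 bs2] f2R f2a f2b]]]] gI gc gd.
    have [f [fB fE fl fg]] := realizes_iso f1R f2R gI.
    have [[h2 dK _] _ _] := f2R.
    have fa : f a1 = a2 by apply: (can_inj dK); rewrite fg f1a gc.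
    have fb : f b1 = b2 by apply: (can_inj dK); rewrite fg f1b gd.
    exists f; split=> //; split=> // u v.
    have rv : retv (@edge n (val N2)) (f v) = retv (@edge n (val N1)) v.
      rewrite /retv -(swap_vdeg (network_net N2) rr2 rs2 ar2 bs2).
      rewrite -(swap_vdeg (network_net N1) rr1 rs1 ar1 bs1).
      by rewrite (iso_vdeg fB fE).
    (* Reading [fE] at the transposed tail recovers the original arcs: [f] conjugates one
       transposition into the other, and each is an involution. *)
    have := fE (tperm a1 b1 u) v; have := fE u v.
    rewrite /swap_edge rv; case: (retv _ v) => // _.
    by rewrite (inj_tperm _ _ _ (bij_inj fB)) fa fb !tpermK.
apply: (@leq_trans (\sum_(c <- C) #|[pred p | X (repr c) p.1 p.2]|)).
  by apply: leq_sum => c _; apply: card_swappable (network_net _).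
apply: leq_trans XY _.
rewrite -sum1_size big_distrl /=.
apply: leq_sum => c _; rewrite mul1n card_pairs.
apply: (@leq_trans (\sum_(a : vert (val (repr c))) 4 ^ L.+2)).
  by apply: leq_sum => a _; apply: card_nearby; apply: net_deg3 (network_net _).
rewrite sum_nat_const leq_mul2r; apply/orP; right.
exact: card_net (network_net _).
Qed.

Lemma connect_up (V : finType) (e : rel V) v y : connect e v y -> v != y ->
  exists2 u, e u y & connect e v u.
Proof.
case/connectP => p; case/lastP: p => [|p w] /=; first by move=> _ ->; rewrite eqxx.
rewrite rcons_path last_rcons => /andP[vp pw] -> _; exists (last v p) => //.
by apply/connectP; exists p.
Qed.

Lemma card_optionP (T : finType) (P : option T -> bool) :
  #|P| = P None + #|[pred v | P (Some v)]|.
Proof.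
rewrite (cardD1 None); congr (_ + _).
transitivity #|[seq Some v | v in [pred v | P (Some v)]]|; last first.
  exact/fintype.card_image/Some_inj.
apply: eq_card => -[v|] /=.
  by rewrite !inE /= fintype.mem_image ?inE //; exact: Some_inj.
by rewrite !inE /=; apply/esym/negP => /fintype.imageP[].
Qed.

Lemma card_option2P (T : finType) (P : option (option T) -> bool) :
  #|P| = P None + P (Some None) + #|[pred v | P (Some (Some v))]|.
Proof. by rewrite !card_optionP addnA. Qed.

(** * Grafting a reticulation above a leaf *)

Section BifurcationChild.
Variables (n : nat) (V : finType) (e : rel V) (l : 'I_n -> V).
Hypothesis N : simplex_net e l.

(* Ancestors of [y] along non-reticulation vertices form a chain, so that [y]
   lies below at most one of the two children of [b]. *)
Lemma bif_children_disjoint b c1 c2 y : ~~ retv e c1 -> ~~ retv e c2 ->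
  e b c1 -> e b c2 -> c1 != c2 ->
  ~~ retv e y -> (forall u, e u y -> ~~ retv e u) ->
  connect e c1 y -> connect e c2 y -> False.
Proof.
move=> r1 r2 bc1 bc2 c12; have [h hP] := net_rank N.
(* A path from [c] to its sibling [c'] would enter [c'] through its only parent [b], which lies
   above [c]: a cycle. *)
have sib c c' : ~~ retv e c' -> e b c -> e b c' -> c != c' -> connect e c c' -> False.
  move=> r' bc bc' cc' /connect_up /(_ cc') [u uc' cu].
  have /negP := connect_asym hP bc.
  by rewrite (parent_uniq N r' bc' uc').
(* Both paths enter [y] through its only parent, to which the induction passes. *)
have [k] := ubnP (h y); elim: k y => // k IH y yk ry py c1y c2y.
have [c1E|/(connect_up c1y)[u uy c1u]] := eqVneq c1 y.
  by apply: (sib c2 c1) => //; rewrite 1?eq_sym // c1E.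
have [c2E|/(connect_up c2y)[u' u'y c2u]] := eqVneq c2 y.
  by apply: (sib c1 c2) => //; rewrite c2E.
rewrite -(parent_uniq N ry uy u'y) in c2u.
apply: (IH u) => //; first exact: leq_trans (hP _ _ uy) _.
  exact: py.
move=> w wu; apply/negP => rw; move: (tail_nleaf uy).
by rewrite (net_one_component N rw wu).
Qed.

Lemma bif_child_nret b c : bif e b -> e b c -> ~~ retv e c.
Proof.
case/andP=> _ /existsPn br bc; apply: contra (br c) => rc.
by rewrite bc.
Qed.

Lemma bif_two_children b : bif e b -> exists c1 c2, [/\ e b c1, e b c2 & c1 != c2].
Proof.
case/andP=> /eqP[_ b2] _.
have /card_gt1P[c1 [c2 [? ? ?]]] : 1 < #|[pred w | e b w]| by rewrite b2.
by exists c1, c2.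
Qed.

(** If the child taken over by the new vertex were above [x], it would lead to the parent of [x] and
    so back to the new vertex, closing a cycle in the grafted graph. *)
Lemma bif_child_apart b x : bif e b -> tleaf e x ->
  exists2 p, e b p & ~~ connect e p x.
Proof.
move=> bb /andP[lx /existsPn px].
have [c1 [c2 [bc1 bc2 c12]]] := bif_two_children bb.
have [c1x|] := boolP (connect e c1 x); last by exists c1.
have [c2x|] := boolP (connect e c2 x); last by exists c2.
exfalso; apply: (bif_children_disjoint (bif_child_nret bb bc1) (bif_child_nret bb bc2)
  bc1 bc2 c12 _ _ c1x c2x); first by rewrite /retv (eqP lx).
by move=> u ux; move: (px u); rewrite ux.
Qed.

End BifurcationChild.

(* In the grafted network, [None] is a new tree vertex on the arc to [x] and
   [Some None] a new reticulation above [x]: the arcs [z -> x] and [b -> p] are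
   replaced by [z -> None -> p], [b -> Some None], [None -> Some None -> x]. *)
Definition graft_edge (V : finType) (e : rel V) (z x b p : V) :
    rel (option (option V)) :=
  fun s t => match s, t with
  | Some (Some u), Some (Some v) => [&& e u v, v != x & v != p]
  | Some (Some u), Some None => u == b
  | Some (Some u), None => u == z
  | Some None, Some (Some v) => v == x
  | None, Some (Some v) => v == p
  | None, Some None => true
  | _, _ => false
  end.

Definition graft_ok (V : finType) (e : rel V) (z x b p : V) :=
  [/\ tleaf e x, bif e b, e z x, e b p & ~~ connect e p x].

Section Graft.
Variables (n : nat) (V : finType) (e : rel V) (l : 'I_n -> V).
Hypothesis N : simplex_net e l.
Variables z x b p : V.
Hypothesis ok : graft_ok e z x b p.
Local Notation e' := (graft_edge e z x b p).
Local Notation old v := (Some (Some v)).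

Let lx : leafv e x. Proof. by case: ok => /andP[]. Qed.
Let zx : e z x. Proof. by case: ok. Qed.
Let bp : e b p. Proof. by case: ok. Qed.
Let bb : bif e b. Proof. by case: ok. Qed.
Let px : ~~ connect e p x. Proof. by case: ok. Qed.
Let tb : treev e b. Proof. by case/andP: bb. Qed.

Let rx : ~~ retv e x. Proof. by rewrite /retv (eqP lx). Qed.
Let rp : ~~ retv e p. Proof. exact: bif_child_nret bb bp. Qed.

Lemma graft_pDx : p != x.
Proof. by apply: contraNneq px => ->; apply: connect0. Qed.

Lemma graft_edge_x v : e v x = (v == z).
Proof. by apply/idP/eqP => [vx|->//]; apply: (parent_uniq N rx vx zx). Qed.

Lemma graft_edge_p v : e v p = (v == b).
Proof. by apply/idP/eqP => [vp|->//]; apply: (parent_uniq N rp vp bp). Qed.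

Lemma graft_edgeE u v :
  e u v = [|| e' (old u) (old v), (u == z) && (v == x) | (u == b) && (v == p)].
Proof.
rewrite /=; have [->|vx] := eqVneq v x; first by rewrite graft_edge_x /=
  (eq_sym x p) (negPf graft_pDx) !andbF andbT orbF.
have [->|vp] := eqVneq v p; first by rewrite graft_edge_p !andbF andbT.
by rewrite !andbF !orbF !andbT.
Qed.

(** Losses and gains balance: [z] trades its child [x] for [None], [b] trades [p] for [Some None],
    while [x] and [p] each trade their only parent for a new one. *)
Lemma graft_vdeg v : vdeg e' (old v) = vdeg e v.
Proof.
congr (_, _).
  rewrite card_option2P /=.
  have [->|vx] := eqVneq v x.
    rewrite eq_sym (negPf graft_pDx) /= eq_card0 => [|u];
      last by rewrite !inE ?eqxx /= ?andbF.
    by have [-> _] := eqP lx.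
  have [->|vp] := eqVneq v p.
    rewrite eq_card0 => [|u]; last by rewrite !inE ?eqxx /= ?andbF.
    by move: rp (head_kind N bp) => /negbTE ->; rewrite orbF => /orP[] /eqP[-> _].
  by rewrite !add0n; apply: eq_card => u; rewrite !inE !andbT.
rewrite card_option2P /= -graft_edge_x -graft_edge_p.
rewrite [RHS](cardD1 x) [X in _ = _ + X](cardD1 p) !inE graft_pDx /= addnA;
  congr (_ + _ + _).
by apply: eq_card => u; rewrite !inE; case: (u == p); case: (u == x);
  rewrite ?andbF ?andbT.
Qed.

Lemma graft_vdeg_tree : vdeg e' None = (1, 2).
Proof. by congr (_, _); rewrite card_option2P /= card1. Qed.

Lemma graft_vdeg_ret : vdeg e' (Some None) = (2, 1).
Proof. by congr (_, _); rewrite card_option2P /= card1. Qed.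

Lemma graft_kind q v : (vdeg e' (old v) == q) = (vdeg e v == q).
Proof. by rewrite graft_vdeg. Qed.

Lemma graft_net : simplex_net e' (fun i => old (l i)).
Proof.
have [h hP] := net_rank N.
have [rt rtP oP] := net_root N.
pose H := (\max_v h v).+1.
have hH v : h v < H by rewrite ltnS; apply: leq_bigmax.
have pb : connect e p b = false by apply/negbTE/(connect_asym hP bp).
have pz : connect e p z = false.
  by apply/negbTE; apply: contra px => pz; apply: connect_trans pz (connect1 zx).
have zDx : (z == x) = false by apply: contraTF zx => /eqP->; rewrite (net_irr N).
have bDx : (b == x) = false.
  by apply/negbTE; apply: contraTneq tb => ->; rewrite /treev (eqP lx).
split.
(* The descendants of [p] are lifted above the new tree vertex, at rank H. Neither [z] nor [b] is
   among them, so both stay below H; the new reticulation and then [x] follow at H + 1 and H + 2. *)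
- exists (fun s => match s with
    | None => H | Some None => H.+1
    | Some (Some v) => if v == x then H.+2
                       else if connect e p v then h v + H.+1 else h v
    end) => -[[u|]|] [[v|]|] //=.
  + move=> /and3P[uv vx vp]; rewrite (negPf vx) ifN; last first.
      by apply: contraTneq lx => <-; apply: tail_nleaf uv.
    have [pu|_] := boolP (connect e p u).
      by rewrite (connect_trans pu (connect1 uv)) ltn_add2r hP.
    case: ifP => _; last exact: hP.
    by apply: leq_trans (hH u) _; rewrite addnS -addSn leq_addl.
  + by move/eqP->; rewrite bDx pb ltnS ltnW.
  + by move/eqP->; rewrite zDx pz.
  + by move/eqP->; rewrite eqxx.
  + by move/eqP->; rewrite (negPf graft_pDx) connect0 addnS ltnS leq_addl.
- exists (old rt); first by rewrite /rootv graft_kind.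
  move=> [[v|]|] vrt; rewrite /leafv /treev /retv ?graft_kind.
  + exact: oP.
  + by rewrite graft_vdeg_ret.
  + by rewrite graft_vdeg_tree.
- by move=> i j [] /(net_label_inj N).
- move=> [[v|]|]; rewrite /leafv ?graft_kind ?graft_vdeg_ret ?graft_vdeg_tree.
  + rewrite -[RHS](net_label_leaf N); apply/codomP/codomP => -[i].
      by case=> ->; exists i.
    by move=> ->; exists i.
  + by apply/negP => /codomP[].
  + by apply/negP => /codomP[].
- move=> [[v|]|]; rewrite /leafv ?graft_kind ?graft_vdeg_ret ?graft_vdeg_tree // => kv.
  (* Only [z] and [b] lose a child. The new tree vertex serves [z]; the other child of [b] remains
     and is no reticulation, as [b] is [bif]. *)
  + have [->|vz] := eqVneq v z.
      by exists None; rewrite /= ?eqxx // /treev graft_vdeg_tree.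
    have [vE|vb] := eqVneq v b; last first.
      have [c vc kc] := net_tree_child N kv.
      exists (old c); last by rewrite /treev !graft_kind.
      rewrite /= vc /=; apply/andP; split.
        by apply: contra_neq vz => cx; move: vc; rewrite cx graft_edge_x => /eqP.
      by apply: contra_neq vb => cp; move: vc; rewrite cp graft_edge_p => /eqP.
    have [c vc cp] : exists2 c, e b c & c != p.
      have [c1 [c2 [bc1 bc2 c12]]] := bif_two_children bb.
      by have [c1p|] := eqVneq c1 p; [exists c2; rewrite // -c1p eq_sym | exists c1].
    exists (old c).
      rewrite /= vE vc cp andbT /=; apply: contra_neq vz => cx.
      by move: vc; rewrite cx graft_edge_x -vE => /eqP.
    rewrite /treev !graft_kind.
    by move: (head_kind N vc); rewrite (negPf (bif_child_nret bb vc)) orbF orbC.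
  + by exists (old x); rewrite /= ?eqxx // /treev !graft_kind (eqP lx).
  + exists (old p); rewrite /= ?eqxx // /treev !graft_kind.
    by move: (head_kind N bp); rewrite (negPf rp) orbF orbC.
- move=> [[u|]|] t; rewrite /retv /leafv ?graft_kind ?graft_vdeg_tree // => ru.
  + move: t => [[v|]|] /=; rewrite ?graft_kind.
    * by move=> /and3P[uv _ _]; apply: net_one_component N _ _ ru uv.
    * by move/eqP => ub; move: tb; rewrite -ub /treev (eqP ru).
    * move/eqP => uz; case: ok => /andP[_ /existsPn /(_ z)].
      by rewrite zx -uz /retv ru.
  + by move: t => [[v|]|] //= /eqP ->; rewrite graft_kind.
Qed.

End Graft.

(** [None] alone undoes the graft: its reticulation child is [Some None], its other child [p], its
    parent [z]; then [x] is the child of [Some None] and [b] the second parent. *)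
Lemma graft_unique n (V1 V2 : finType) (e1 : rel V1) (e2 : rel V2)
    (l1 : 'I_n -> V1) (l2 : 'I_n -> V2) z1 x1 b1 p1 z2 x2 b2 p2 f :
  simplex_net e1 l1 -> simplex_net e2 l2 ->
  graft_ok e1 z1 x1 b1 p1 -> graft_ok e2 z2 x2 b2 p2 ->
  bijective f ->
  (forall s t, graft_edge e2 z2 x2 b2 p2 (f s) (f t) = graft_edge e1 z1 x1 b1 p1 s t) ->
  (forall i, f (Some (Some (l1 i))) = Some (Some (l2 i))) -> f None = None ->
  exists f0 : V1 -> V2, [/\ bijective f0, forall u v, e2 (f0 u) (f0 v) = e1 u v,
    forall i, f0 (l1 i) = l2 i & f0 x1 = x2 /\ f0 b1 = b2].
Proof.
move=> N1 N2 ok1 ok2 fB fE fl fN.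
have fI := bij_inj fB.
have fR : f (Some None) = Some None.
  have := fE None (Some None); rewrite fN.
  have := iso_vdeg fB fE (Some None); rewrite graft_vdeg_ret.
  case: (f _) => [[w|]|] //= + /eqP wE.
  rewrite (graft_vdeg N2 ok2) wE => rp; case: ok2 => _ bb2 _ bp2 _.
  by have := bif_child_nret bb2 bp2; rewrite /retv rp.
have fold v : {w | f (Some (Some v)) = Some (Some w)}.
  case E : (f (Some (Some v))) => [[w|]|]; first by exists w.
    by move: E; rewrite -fR => /fI.
  by move: E; rewrite -fN => /fI.
pose f0 v := sval (fold v).
have f0E v : f (Some (Some v)) = Some (Some (f0 v)) by apply: svalP (fold v).
have f0x : f0 x1 = x2.
  by have := fE (Some None) (Some (Some x1)); rewrite fR f0E /= eqxx => /eqP.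
have f0p : f0 p1 = p2.
  by have := fE None (Some (Some p1)); rewrite fN f0E /= eqxx => /eqP.
have f0z : f0 z1 = z2.
  by have := fE (Some (Some z1)) None; rewrite fN f0E /= eqxx => /eqP.
have f0b : f0 b1 = b2.
  by have := fE (Some (Some b1)) (Some None); rewrite fR f0E /= eqxx => /eqP.
have f0I : injective f0.
  move=> u v uv; suff : Some (Some u) = Some (Some v) by case.
  by apply: fI; rewrite !f0E uv.
exists f0; split=> //.
- apply: inj_card_bij f0I _.
  by have := bij_eq_card fB; rewrite !card_option => -[->].
- move=> u v; rewrite (graft_edgeE N1 ok1) (graft_edgeE N2 ok2) -!f0E fE.
  by rewrite -f0x -f0p -f0z -f0b !(inj_eq f0I).
- by move=> i; have := fl i; rewrite f0E => -[].
Qed.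

(** By [card_bif] there are m (m - 1) pairs to switch. The trace is one parent of a reticulation, of
    which there are 2r <= 2n; it is doubled into a diagonal pair to fit [sum_card_pairs_le]. *)
Lemma sum_tleaf n (C := fset_set [set: network_class n]%classic) :
  \sum_(c <- C) #|tleaf (@edge n (val (repr c)))| *
    (#|tleaf (@edge n (val (repr c)))|).-1 <= #|` C|%fset * (2 * n).
Proof.
pose X (N : network n) x b := tleaf (@edge n (val N)) x && bif (@edge n (val N)) b.
pose Y (N : network n) c d := (c == d) && rchild (@edge n (val N)) c.
pose T (N M : network n) (x b : vert (val N)) (c d : vert (val M)) :=
  exists z p f, [/\ graft_ok (@edge n (val N)) z x b p,
    realizes (graft_edge (@edge n (val N)) z x b p)
      (fun i => Some (Some (@label n (val N) i))) f, f None = c & f None = d].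
have XY : \sum_(c <- C) #|[pred p | X (repr c) p.1 p.2]| <=
          \sum_(c <- C) #|[pred p | Y (repr c) p.1 p.2]|.
  apply: (@sum_card_pairs_le n X Y T).
  - move=> N M f a b [fB fE _] /andP[/eqP-> /existsP[r /andP[br rr]]].
    rewrite /Y eqxx; apply/existsP; exists (f r).
    by rewrite fE br /retv (iso_vdeg fB fE).
  - move=> N x b /andP[tx bb].
    have [p bp px] := bif_child_apart (network_net N) bb tx.
    have [z zx] : exists z, edge z x.
      have /card_gt0P[z zx] : 0 < #|[pred z | edge z x]|.
        by case/andP: tx => /eqP[-> _].
      by exists z.
    have ok : graft_ok (@edge n (val N)) z x b p by [].
    have [M [f [fB fE fl]]] := realize (graft_net (network_net N) ok).
    exists M, (f None), (f None); split; first by exists z, p, f.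
    rewrite /Y eqxx; apply/existsP; exists (f (Some None)).
    by rewrite fE /retv (iso_vdeg fB fE) graft_vdeg_ret.
  - move=> N1 N2 M1 M2 x1 b1 x2 b2 c1 d1 c2 d2 g.
    move=> [z1 [p1 [f1 [ok1 f1R f1c _]]]] [z2 [p2 [f2 [ok2 f2R f2c _]]]] gI gc _.
    have [f [fB fE fl fg]] := realizes_iso f1R f2R gI.
    have [[h2 dK _] _ _] := f2R.
    have fN : f None = None by apply: (can_inj dK); rewrite fg f1c gc.
    have [f0 [f0B f0E f0l [f0x f0b]]] :=
      graft_unique (network_net N1) (network_net N2) ok1 ok2 fB fE fl fN.
    by exists f0.
apply: leq_trans (leq_trans XY _); last first.
  rewrite -sum1_size big_distrl /=.
  apply: leq_sum => c _; rewrite mul1n card_pairs.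
  have := card_tleaf (network_net (repr c)); have := card_rchild (network_net (repr c)).
  rewrite -sum_bool => cr ct.
  apply: (@leq_trans (\sum_v rchild (@edge n (val (repr c))) v)); last by rewrite cr;
    lia.
  apply: leq_sum => a _; rewrite /Y.
  case: (rchild _ _); last by rewrite eq_card0 // => v; rewrite !inE andbF.
  rewrite -[leqRHS](card1 a).
  by apply/subset_leq_card/fintype.subsetP => v; rewrite !inE andbT eq_sym.
apply: leq_sum => c _; rewrite card_pairs.
rewrite -(card_bif (network_net (repr c))) addn1 /= -addn1.
rewrite (card_bif (network_net (repr c))) -sum_nat_const.
rewrite [leqRHS](bigID (tleaf (@edge n (val (repr c))))) /=.
apply: leq_trans (leq_addr _ _); apply: leq_sum => x tx.
by apply/subset_leq_card/fintype.subsetP => b bb; rewrite inE; apply/andP; split.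
Qed.

(** * Unfolding a network around a leaf *)

HB.instance Definition _ := gen_eqMixin lim_vertex.

Lemma lim_arcE u v : lim_arc u v <->
  match u, v with
  | SpineV s i, SpineV t j => s = t /\ j = (i + 1)%R
  | SpineV s i, Rho t j => s = t /\ i = val j \/ s = SpineOf t j /\ i = 0%R
  | SpineV s i, Rho0 => (s = SpineP \/ s = SpineQ) /\ i = 0%R
  | Rho s i, Ell t j => s = t /\ i = j
  | Rho0, Ell0 => True
  | _, _ => False
  end.
Proof.
split; first by case; intuition.
case: u v => [s i|s i|s i||] [t j|t j|t j||] //.
- by case=> -> ->; constructor.
- by case=> -[-> ->]; constructor.
- by case=> -[] -> ->; constructor.
- by case=> -> ->; constructor.
- by constructor.
Qed.

(** This is the height of index 0. On [SpineOf s i] that vertex is two steps from the vertex it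
    decorates, through their common reticulation child. *)
Fixpoint spine_height (s : spine) : nat :=
  if s is SpineOf s' i then spine_height s' + absz (val i) + 2 else 2.

(* The distance to [Ell0]. *)
Definition height (v : lim_vertex) : nat :=
  match v with
  | SpineV s i => spine_height s + absz i
  | Rho s i => spine_height s + absz (val i) + 1
  | Ell s i => spine_height s + absz (val i) + 2
  | Rho0 => 1
  | Ell0 => 0
  end.

Definition lim_adj u v : bool := `[< lim_arc u v \/ lim_arc v u >].

Lemma lim_adjC u v : lim_adj u v = lim_adj v u.
Proof. by apply/asboolP/asboolP => -[]; [right|left|right|left]. Qed.

Lemma lim_arc_adj u v : lim_arc u v -> lim_adj u v.
Proof. by move=> uv; apply/asboolP; left. Qed.

Lemma height_adj u v : lim_adj u v -> height v <= (height u).+1.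
Proof.
have harc x y : lim_arc x y -> height y <= (height x).+1 /\ height x <= (height y).+1.
  by case=> [s i||||s i|s i|s i] /=; lia.
by case/asboolP => /harc[].
Qed.

Lemma height_path u p x : path lim_adj u p -> x \in u :: p ->
  height x <= height u + size p.
Proof.
elim: p u => [|y p IH] u /=; first by rewrite inE => _ /eqP ->; rewrite addn0.
move=> /andP[uy yp]; rewrite inE => /orP[/eqP->|/(IH _ yp)]; first exact: leq_addr.
by move: (height_adj uy); lia.
Qed.

Lemma lim_distP r u v : @dist_le leaf_limit r u v <->
  exists p, [/\ path lim_adj u p, last u p = v & size p <= r].
Proof.
split.
  elim: r u => [|r IH] u /=; first by move=> ->; exists [::].
  case=> [->|[x [ux /IH[p [xp pv pr]]]]]; first by exists [::].
  by exists (x :: p); split=> //=; rewrite xp andbT; apply/asboolP.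
case=> p []; elim: p r u => [|x p IH] [|r] u //=.
- by move=> _ ->; left.
- by case/andP=> /asboolP ux xp pv pr; right; exists x; split=> //; apply: IH.
Qed.

(** Only spine vertices have two children, one on the spine and one reticulation. At index 0 the
    latter is the reticulation that opened the spine, at other indices the decoration. *)
Lemma lim_out_uniq u v v' : lim_arc u v -> lim_arc u v' ->
  lim_mark v = lim_mark v' -> v = v'.
Proof.
move=> /lim_arcE + /lim_arcE.
case: u => [s i|s i|s i||]; case: v => [t j|t j|t j||] //;
  case: v' => [t' j'|t' j'|t' j'||] //=.
- by case=> -> -> [-> ->].
- case=> [[-> ->]|[-> ->]] [[tE jE]|[tE jE]] _.
  + by rewrite tE (val_inj jE).
  + by move: (valP j); rewrite /= jE.
  + by move: (valP j'); rewrite /= -jE.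
  + by case: tE => -> ->.
- case=> [[-> ->]|[-> ->]] [[sE|sE] jE] //; by move: (valP j); rewrite /= jE.
- move=> [[sE|sE] ->] [[tE jE]|[tE jE]] //; rewrite -?sE ?tE //.
  + by move: (valP j'); rewrite /= -jE.
  + by move: sE; rewrite tE.
  + by move: (valP j'); rewrite /= -jE.
  + by move: sE; rewrite tE.
- by case=> -> -> [-> ->].
Qed.

Lemma arc_adj (V : finType) (e : rel V) u v : e u v -> adj e u v.
Proof. by rewrite /adj => ->. Qed.

Lemma arc_adjr (V : finType) (e : rel V) u v : e u v -> adj e v u.
Proof. by rewrite /adj => ->; rewrite orbT. Qed.

Section Local.
Variables (n : nat) (V : finType) (e : rel V) (l : 'I_n -> V).
Hypothesis N : simplex_net e l.
Variables (K L : nat) (w : V).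

Definition bad_vertex v :=
  [|| rootv e v, bif e v, tleaf e v | short_parent e L v].

Hypothesis leaf_w : leafv e w.
Hypothesis good : forall v, nearby e K w v -> ~~ bad_vertex v.

(** These choices fall back on an argument when no vertex qualifies; goodness near [w] rules this
    out wherever their values matter. *)
Definition parent v := odflt v [pick u | e u v].
Definition child v := odflt v [pick u | e v u].
Definition tchild v := odflt v [pick u | e v u && ~~ retv e u].
Definition rchild_of v := odflt v [pick u | e v u && retv e u].
Definition coparent r u := odflt r [pick u' | e u' r && (u' != u)].

(** [Negz k] is -(k+1), hence [k.+1] steps up. *)
Definition walk (v : V) (i : int) : V :=
  match i with Posz k => iter k tchild v | Negz k => iter k.+1 parent v end.

(** Which parent of the reticulation above [w] starts [SpineP] is arbitrary: the limit is symmetric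
    in its two first spines. *)
Fixpoint base (s : spine) : V :=
  match s with
  | SpineP => parent (parent w)
  | SpineQ => coparent (parent w) (parent (parent w))
  | SpineOf s' i => let x := walk (base s') (val i) in coparent (rchild_of x) x
  end.

(* Maps the limit to the network locally isomorphically as long as no bad vertex
   is met; further away it takes arbitrary values. *)
Definition unfold (v : lim_vertex) : V :=
  match v with
  | SpineV s i => walk (base s) i
  | Rho s i => rchild_of (walk (base s) (val i))
  | Ell s i => child (rchild_of (walk (base s) (val i)))
  | Rho0 => parent w
  | Ell0 => w
  end.

Definition of_kind (k : kind) : pred V :=
  match k with
  | RootKind => rootv e | TreeKind => treev e
  | RetKind => retv e | LeafKind => leafv e
  end.

Lemma kind_uniq k k' v : of_kind k v -> of_kind k' v -> k = k'.
Proof.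
by case: k; case: k' => //=; rewrite /rootv /treev /retv /leafv => /eqP ->.
Qed.

Lemma parentP v : treev e v || leafv e v -> e (parent v) v.
Proof.
rewrite /parent; case: pickP => // vP kv.
have /card_gt0P[u] : 0 < (vdeg e v).1 by case/orP: kv => /eqP ->.
by rewrite inE; move: (vP u) => /= ->.
Qed.

Lemma coparentP r u : retv e r -> e (coparent r u) r /\ coparent r u != u.
Proof.
move=> rr; rewrite /coparent; case: pickP => [u' /andP[] //|rP].
by have [u' u'r u'u] := ret_other_parent u rr; move: (rP u'); rewrite u'r u'u.
Qed.

Lemma childP r : retv e r -> e r (child r) /\ leafv e (child r).
Proof.
move=> rr; have [v rv lv] := ret_child N rr; rewrite /child.
case: pickP => [v' rv'|/(_ v)]; last by rewrite rv.
by rewrite (ret_child_uniq rr rv' rv).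
Qed.

Lemma rchild_ofP k v : k <= K -> nearby e k w v -> treev e v ->
  e v (rchild_of v) /\ retv e (rchild_of v).
Proof.
move=> kK wv tv; have := good (nearby_leq kK wv); rewrite /bad_vertex !negb_or.
case/and4P=> _; rewrite /bif tv negbK => /existsP[r vr] _ _.
by rewrite /rchild_of; case: pickP => [u /andP[]|/(_ r)] //; rewrite vr.
Qed.

Lemma nearby_step k u v : nearby e k w u -> adj e u v -> nearby e k.+1 w v.
Proof. by move=> wu uv; rewrite -addn1; apply: nearby_trans wu (nearby_adj uv). Qed.

(** Tree-child yields a child that is no reticulation. It is not a leaf either, since a good leaf
    hangs below a reticulation and its parent is unique. *)
Lemma tchildP k v : k < K -> nearby e k w v -> treev e v ->
  [/\ e v (tchild v), treev e (tchild v) & nearby e k.+1 w (tchild v)].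
Proof.
move=> kK wv tv.
have vc : e v (tchild v) && ~~ retv e (tchild v).
  rewrite /tchild; case: pickP => [//|vP].
  have [|c vc kc] := net_tree_child N (u := v); first by rewrite /leafv (eqP tv).
  move: (vP c); rewrite vc /= => /negbFE rc.
  by move: kc; rewrite /treev /leafv (eqP rc).
have [{}vc rc] := andP vc.
have wc : nearby e k.+1 w (tchild v) by apply: nearby_step wv _; rewrite /adj vc.
split=> //; move: (head_kind N vc); rewrite (negPf rc) orbF => /orP[lc|//].
have := good (nearby_leq kK wc); rewrite /bad_vertex !negb_or.
case/and4P=> _ _; rewrite /tleaf lc negbK => /existsP[u /andP[uc ru]] _.
by move: tv; rewrite (parent_uniq N rc vc uc) /treev (eqP ru).
Qed.

(** The parent is not the root, which is bad, nor a reticulation, whose child would be a leaf. *)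
Lemma tree_parentP k v : k < K -> nearby e k w v -> treev e v ->
  [/\ e (parent v) v, treev e (parent v) & nearby e k.+1 w (parent v)].
Proof.
move=> kK wv tv; have uv : e (parent v) v by apply: parentP; rewrite tv.
have wu : nearby e k.+1 w (parent v) by apply: nearby_step wv _; rewrite /adj uv orbT.
split=> //; case/or4P: (net_kind N (parent v)) => // [ru|lu|ru].
- by have := good (nearby_leq kK wu); rewrite /bad_vertex ru.
- by move: (tail_nleaf uv); rewrite lu.
- by move: (net_one_component N ru uv); rewrite /leafv (eqP tv).
Qed.

Lemma walkP k v i : k + absz i <= K -> nearby e k w v -> treev e v ->
  treev e (walk v i) /\ nearby e (k + absz i) w (walk v i).
Proof.
move=> + wv tv; case: i => [j|j] /=.
  elim: j => [|j IH] kK; first by rewrite addn0.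
  have [|tj wj] := IH; first by lia.
  have [|_ ? ?] := tchildP _ wj tj; first by lia.
  by rewrite addnS.
elim: j => [|j IH] kK.
  have [|_ ? ?] := tree_parentP _ wv tv; first by lia.
  by rewrite addn1.
have [|tj wj] := IH; first by lia.
have [|_ ? ?] := tree_parentP _ wj tj; first by lia.
by rewrite addnS.
Qed.

Lemma root_ret : retv e (parent w) /\ e (parent w) w.
Proof.
have := good (nearby_refl e K w); rewrite /bad_vertex !negb_or.
case/and4P=> _ _; rewrite /tleaf leaf_w negbK => /existsP[u /andP[uw ru]] _.
have pw : e (parent w) w by apply: parentP; rewrite leaf_w orbT.
split=> //; rewrite (parent_uniq N _ pw uw) //.
by rewrite /retv (eqP leaf_w).
Qed.

Lemma ret_parentP r : retv e r -> e (parent r) r.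
Proof.
move=> rr; rewrite /parent; case: pickP => // rP.
by have [u ur _] := ret_other_parent r rr; move: (rP u); rewrite ur.
Qed.

Lemma baseP s : spine_height s <= K ->
  treev e (base s) /\ nearby e (spine_height s) w (base s).
Proof.
have [rw pw] := root_ret; have ppw := ret_parentP rw.
have [cpw _] := coparentP (parent (parent w)) rw.
have w1 : nearby e 1 w (parent w) by apply: nearby_adj; rewrite /adj pw orbT.
elim: s => [||s IH i].
- by split;
    [exact: (ret_parent_tree N rw ppw)|apply: nearby_step w1 _; rewrite /adj ppw orbT].
- by split;
    [exact: (ret_parent_tree N rw cpw)|apply: nearby_step w1 _; rewrite /adj cpw orbT].
rewrite -[spine_height (SpineOf s i)]/(spine_height s + absz (val i) + 2) addn2 => hK.
have [|ts ws] := IH; first by lia.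
have [|tx wx] := walkP (i := val i) _ ws ts; first by lia.
have [|xr rx] := rchild_ofP _ wx tx; first by lia.
have [cx _] := coparentP (walk (base s) (val i)) rx.
split; first exact: (ret_parent_tree N rx cx).
exact: nearby_step (nearby_step wx (arc_adj xr)) (arc_adjr cx).
Qed.

Lemma unfoldP v : height v <= K ->
  of_kind (lim_mark v) (unfold v) /\ nearby e (height v) w (unfold v).
Proof.
have spineP s i : height (SpineV s i) <= K ->
    treev e (walk (base s) i) /\ nearby e (spine_height s + absz i) w (walk (base s) i).
  move=> /= hK; have [|ts ws] := @baseP s; first by lia.
  exact: walkP.
case: v => [s i|s i|s i||] /=; first exact: spineP.
- rewrite addn1 => hK; have [|tx wx] := spineP s (val i); first exact: ltnW hK.
  have [|xr rx] := rchild_ofP _ wx tx; first exact: ltnW hK.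
  by split=> //; apply: nearby_step wx _; rewrite /adj xr.
- rewrite addn2 => hK; have [|tx wx] := spineP s (val i); first exact: ltnW (ltnW hK).
  have [|xr rx] := rchild_ofP _ wx tx; first exact: ltnW (ltnW hK).
  have [rl ll] := childP rx; split=> //.
  exact: nearby_step (nearby_step wx (arc_adj xr)) (arc_adj rl).
- by have [rw pw] := root_ret; split=> //; apply: nearby_adj; rewrite /adj pw orbT.
- by rewrite leaf_w eqxx.
Qed.

Lemma unfold_arc u v : height u <= K -> height v <= K -> lim_arc u v ->
  e (unfold u) (unfold v).
Proof.
move=> + + uv; have [rw pw] := root_ret; have ppw := ret_parentP rw.
case: uv => [s [j|[|j]]||||s i|s i|s i] hu hv.
- have -> : (Posz j + 1 = Posz j.+1)%R by lia.
  have [tu wu] := unfoldP hu.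
  by have [|? _ _] := tchildP _ wu tu; first by move: hv => /=; lia.
(* At negative indices the walk was built upwards, so the arc comes from [parentP] at its head. *)
- have -> : (Negz 0 + 1 = 0)%R by lia.
  have [tu wu] := unfoldP hv.
  by apply: parentP; rewrite [treev _ _]tu.
- have vE : (Negz j.+1 + 1 = Negz j)%R by lia.
  rewrite vE in hv *; have [tu wu] := unfoldP hv.
  by apply: parentP; rewrite [treev _ _]tu.
- exact: ppw.
- by have [] := coparentP (parent (parent w)) rw.
- exact: pw.
- have [tu wu] := unfoldP hu.
  by have [] := rchild_ofP hu wu tu.
- have [|rr wr] := @unfoldP (Rho s i); first exact: hv.
  by have [] := coparentP (walk (base s) (val i)) rr.
- have [rr wr] := unfoldP hu.
  by have [] := childP rr.
Qed.

Lemma spine_ret_child s i : exists2 r, lim_arc (SpineV s i) r & lim_mark r = RetKind.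
Proof.
have [->|i0] := eqVneq i 0%R; last first.
  by exists (Rho s (exist _ i i0)) => //; exact: (@arc_x_rho s (exist _ i i0)).
case: s => [||s j]; [exists Rho0|exists Rho0|exists (Rho s j)] => //; by constructor.
Qed.

(** Half of the covering property of [unfold]. The limit vertex already has a child of each kind
    allowed, and [y] is the image of the one of its kind by uniqueness in the network. *)
Lemma unfold_lift_out v y : height v < K -> e (unfold v) y ->
  exists2 v', lim_arc v v' & unfold v' = y.
Proof.
move=> hv vy; have [kv _] := unfoldP (ltnW hv).
have out v' : lim_arc v v' -> of_kind (lim_mark v') (unfold v') /\ e (unfold v) (unfold v').
  move=> vv'; have hv' := leq_trans (height_adj (lim_arc_adj vv')) hv.
  split; [exact: (unfoldP hv').1 | exact: unfold_arc (ltnW hv) hv' vv'].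
case: v hv vy kv out => [s i|s i|s i||] hv vy kv out.
- have [r vr rK] := spine_ret_child s i; have [rr er] := out _ vr; rewrite rK in rr.
  have [ry|ry] := boolP (retv e y).
    by exists r => //; apply: (rchild_uniq N) er vy.
  exists (SpineV s (i + 1)); first by constructor.
  have [tc ec] := out _ (arc_spine s i).
  apply: (nrchild_uniq N _ _ ry ec vy); first by apply/existsP; exists (unfold r);
    rewrite er.
  by rewrite /retv (eqP tc).
- exists (Ell s i); first by constructor.
  by apply: (ret_child_uniq kv) vy; have [] := out _ (arc_rho_ell s i).
- by move: (tail_nleaf vy); rewrite [leafv _ _]kv.
- exists Ell0; first by constructor.
  by apply: (ret_child_uniq kv) vy; have [] := out _ arc_rho0_ell0.
- by move: (tail_nleaf vy); rewrite [leafv _ _]kv.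
Qed.

Lemma lim_ret_parents v : lim_mark v = RetKind -> height v <= K ->
  exists u1 u2, [/\ lim_arc u1 v, lim_arc u2 v, unfold u1 != unfold u2 &
    forall u, lim_arc u v -> u = u1 \/ u = u2].
Proof.
case: v => [s i|s i|s i||] // _ hv.
- exists (SpineV s (val i)), (SpineV (SpineOf s i) 0); split; try by constructor.
    have [rr _] := unfoldP hv.
    by have [_] := coparentP (walk (base s) (val i)) rr; rewrite eq_sym.
  move=> u /lim_arcE; case: u => //= t j [[-> ->]|[-> ->]]; by [left|right].
- exists (SpineV SpineP 0), (SpineV SpineQ 0); split; try by constructor.
    have [rr _] := root_ret.
    by have [_] := coparentP (parent (parent w)) rr; rewrite eq_sym.
  move=> u /lim_arcE; case: u => //= t j [[->|->] ->]; by [left|right].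
Qed.


(** The other half: tree vertices and leaves have one parent, and the two limit parents of a
    reticulation unfold to different vertices, hence to all its parents. *)
Lemma unfold_lift_in v y : height v < K -> e y (unfold v) ->
  exists2 v', lim_arc v' v & unfold v' = y.
Proof.
move=> hv yv; have [kv _] := unfoldP (ltnW hv).
have inn v' : lim_arc v' v -> e (unfold v') (unfold v).
  move=> v'v; have hv' : height v' <= K.
    by apply: leq_trans (height_adj _) hv; rewrite lim_adjC lim_arc_adj.
  exact: unfold_arc hv' (ltnW hv) v'v.
have tree_case v' : ~~ retv e (unfold v) -> lim_arc v' v ->
    exists2 v', lim_arc v' v & unfold v' = y.
  by move=> rv v'v; exists v' => //; apply: (parent_uniq N rv) yv; apply: inn.
case vM : (lim_mark v) => [|||].
- by case: v vM {hv yv kv inn tree_case}.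
- rewrite vM in kv;
    case: v vM hv yv kv inn tree_case => // s i _ _ _ kv _ /(_ (SpineV s (i - 1))).
  apply; first by rewrite /retv (eqP kv).
  by apply/lim_arcE; split=> //; lia.
- have [u1 [u2 [u1v u2v u12 _]]] := lim_ret_parents vM (ltnW hv).
  rewrite vM in kv.
  by case/orP: (ret_parent_cases kv (inn _ u1v) (inn _ u2v) u12 yv) => /eqP ->;
    [exists u1|exists u2].
- rewrite vM in kv; have rv : ~~ retv e (unfold v) by rewrite /retv (eqP kv).
  case: v vM hv yv kv inn tree_case rv => // [s i|] _ _ _ kv _ + rv.
    by move=> /(_ (Rho s i) rv); apply; constructor.
  by move=> /(_ Rho0 rv); apply; constructor.
Qed.

(** Two children are told apart by their marks, a child from a parent by acyclicity, two parents of
    a reticulation by [coparent]. *)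
Lemma unfold_locally_inj v v1 v2 : height v < K -> lim_adj v v1 -> lim_adj v v2 ->
  unfold v1 = unfold v2 -> v1 = v2.
Proof.
move=> hv vv1 vv2 v12.
have h1 := leq_trans (height_adj vv1) hv; have h2 := leq_trans (height_adj vv2) hv.
have [k1 _] := unfoldP h1; have [k2 _] := unfoldP h2.
have k12 : lim_mark v1 = lim_mark v2 by apply: kind_uniq k1 _; rewrite v12.
have arcs x y : height x <= K -> height y <= K -> lim_arc x y ->
  e (unfold x) (unfold y) by exact: unfold_arc.
case/asboolP: vv1 => a1; case/asboolP: vv2 => a2.
- exact: lim_out_uniq a1 a2 k12.
- have := net_asym N (arcs _ _ (ltnW hv) h1 a1).
  by rewrite v12 (arcs _ _ h2 (ltnW hv) a2).
- have := net_asym N (arcs _ _ (ltnW hv) h2 a2).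
  by rewrite -v12 (arcs _ _ h1 (ltnW hv) a1).
case vM : (lim_mark v) => [|||].
- by case: v vM {hv a1 a2}.
- case: v vM {hv} a1 a2 => // s i _ /lim_arcE + /lim_arcE.
  case: v1 {v12 h1 k1 k12} => // s1 i1; case: v2 {h2 k2} => // s2 i2.
  by move=> [-> ->] [-> /GRing.addIr ->].
- have [u1 [u2 [u1v u2v u12 uP]]] := lim_ret_parents vM (ltnW hv).
  by case: (uP _ a1) (uP _ a2) v12 u12 => -> [] -> // ->; rewrite eqxx.
- case: v vM {hv} a1 a2 => // [s i|] _ /lim_arcE + /lim_arcE.
    case: v1 {v12 h1 k1 k12} => // s1 i1; case: v2 {h2 k2} => // s2 i2.
    by move=> [-> ->] [-> ->].
  by case: v1 {v12 h1 k1 k12} => //; case: v2 {h2 k2}.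
Qed.

(* The vertex of largest rank on an undirected cycle is a reticulation, and the
   rest of the cycle joins its two parents. *)
Lemma no_short_cycle c : cycle (adj e) c -> uniq c -> 2 < size c <= L.+2 ->
  (forall y, y \in c -> ~~ short_parent e L y) -> False.
Proof.
move=> cc uc /andP[c3 cL] cP; have [h hP] := net_rank N.
have [y yc] : exists y, y \in c by case: (c) c3 => // y c' _; exists y; apply: mem_head.
case: (@arg_maxnP _ y (mem c) h yc) => x xc xmax.
have [i s sE] := rot_to xc.
(* The cycle is rotated to start at [x]: its neighbours there are [a] and [last a s], and [s] is the
   detour, of length at most L. *)
have := cc; rewrite -(rot_cycle i) sE; have := uc; rewrite -(rot_uniq i) sE.
have := c3; have := cL; rewrite -(size_rot i) sE.
have {}cP z : z \in x :: s -> ~~ short_parent e L z by rewrite -sE mem_rot; apply: cP.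
have {}xmax z : z \in x :: s -> h z <= h x by rewrite -sE mem_rot; apply: xmax.
case: s {sE} cP xmax => // a s cP xmax sL s3 /= /and3P[xs as_ us] /andP[xa].
rewrite rcons_path => /andP[aps sx].
have below z : z \in x :: a :: s -> adj e z x -> e z x.
  by move=> /xmax zx /orP[//|/hP]; rewrite ltnNge zx.
have ax : e a x by apply: below; rewrite 1?adjC // !inE eqxx orbT.
have lx : e (last a s) x by apply: below => //; rewrite inE mem_last orbT.
have la : last a s != a.
  by case: s s3 as_ {cP xmax sL xs us aps sx below lx} => //= b s _;
    apply: contraNneq => <-; apply: mem_last.
have rx : retv e x.
  apply: contraNT la => rx; apply/eqP; exact: (parent_uniq N rx lx ax).
move: (cP a); rewrite !inE eqxx orbT => /(_ isT) /negP; apply.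
apply/asboolP; exists x, (last a s), s; split=> //; split=> //.
Qed.

(** By induction a first repetition involves [unfold u]; the part of the path up to it maps to a
    closed walk in the network with distinct vertices. *)
Lemma unfold_uniq u p : path lim_adj u p -> uniq (u :: p) ->
  (forall v, v \in u :: p -> height v < K) -> size p <= L.+2 ->
  uniq (map unfold (u :: p)).
Proof.
have edge_adj x y : height x < K -> lim_adj x y -> adj e (unfold x) (unfold y).
  move=> hx xy; have hy := leq_trans (height_adj xy) hx.
  case/asboolP: xy => xy; first exact/arc_adj/(unfold_arc (ltnW hx)).
  exact/arc_adjr/(unfold_arc hy (ltnW hx)).
have map_path x s : path lim_adj x s -> (forall v, v \in x :: s -> height v < K) ->
    path (adj e) (unfold x) (map unfold s).
  elim: s x => //= y s IH x /andP[xy ys] hs; apply/andP; split.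
    by apply: edge_adj xy; apply: hs; apply: mem_head.
  by apply: IH => // v vs; apply: hs; rewrite inE vs orbT.
elim: p u => [//|x p IH] u /andP[ux xp] up hp pL.
have hx v : v \in x :: p -> height v < K by move=> vp; apply: hp; rewrite inE vp orbT.
have uq : uniq (map unfold (x :: p)).
  by apply: IH => //; [case/andP: up | exact: ltnW].
rewrite map_cons cons_uniq uq andbT.
apply/negP => um; set j := index (unfold u) (map unfold (x :: p)).
have jp : j < size (x :: p) by rewrite -(size_map unfold) index_mem.
pose q := take j p.
have jE : map unfold (x :: q) = take j.+1 (map unfold (x :: p)) by rewrite -map_take.
have lq : unfold (last x q) = unfold u.
  have -> : last x q = nth x (x :: p) j.
    rewrite (last_nth x) /q size_takel; last by rewrite -ltnS.
    by case: (j) => // k /=; rewrite nth_take.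
  by rewrite -(nth_map x (unfold x)) // nth_index.
have qp v : v \in x :: q -> v \in x :: p.
  by rewrite !inE => /orP[->//|/mem_take ->]; rewrite orbT.
have xq : path lim_adj x q by apply: take_path.
have hq v : v \in x :: q -> height v < K by move=> /qp /hx.
have upath : path (adj e) (unfold x) (map unfold q) by apply: map_path.
have sq : size q = j by rewrite size_takel // -ltnS.
have closes : adj e (unfold u) (unfold x).
  by apply: edge_adj ux; apply: hp; apply: mem_head.
(* The closed walk has j + 1 vertices: a loop for j = 0, a backtracking step for j = 1, excluded by
   local injectivity, and a short cycle for j >= 2. *)
case: (ltngtP j 1) => [j0|j2|j1].
- have q0 : q = [::] by apply: size0nil; rewrite sq; case: (j) j0.
  by move: closes; rewrite -lq q0 /= /adj (net_irr N).
- apply: (@no_short_cycle (map unfold (x :: q))).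
  + by rewrite /= rcons_path upath last_map lq closes.
  + by rewrite jE take_uniq.
  + by rewrite size_map /= sq ltnS j2; apply: leq_trans jp pL.
  + move=> _ /mapP[v vq ->]; have hv := hq _ vq.
    have [_ wv] := unfoldP (ltnW hv).
    have := good (nearby_leq (ltnW hv) wv).
    by rewrite /bad_vertex !negb_or => /and4P[].
case: (q) sq qp lq xq => [|y [|? ?]]; rewrite j1 // => _ qp lq /andP[xy _].
have uy : u = y.
  apply: (unfold_locally_inj (hx x (mem_head _ _)) _ xy); first by rewrite lim_adjC.
  by rewrite -lq.
by case/andP: up => /negP + _; apply; rewrite uy qp // !inE eqxx orbT.
Qed.

(** Joining both vertices through [Ell0] and shortening gives a simple path of length at most 2r,
    along which [unfold] repeats no value. *)
Lemma unfold_inj r u v : r < K -> 2 * r <= L.+2 ->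
  ball_set leaf_limit r u -> ball_set leaf_limit r v -> unfold u = unfold v -> u = v.
Proof.
move=> rK rL /lim_distP[p [up pu pr]] /lim_distP[q [vq qv qr]] uv.
pose p' := rev (belast Ell0 p).
have up' : path lim_adj u p'.
  by rewrite -pu rev_path; rewrite (eq_path (e' := lim_adj)) // => x y; exact: lim_adjC.
have p'E : last u p' = Ell0.
  by rewrite /p'; case: (p) pu => [|x p1] //= _; rewrite rev_cons last_rcons.
have path_uv : path lim_adj u (p' ++ q) by rewrite cat_path up' p'E.
have : last u (p' ++ q) = v by rewrite last_cat p'E.
case: (shortenP path_uv) => s us uns sub lsv.
have hs x : x \in u :: s -> height x < K.
  have hp y : y \in Ell0 :: p -> height y < K.
    by move=> /(height_path up) /= yh; apply: leq_ltn_trans yh _;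
      apply: leq_ltn_trans pr rK.
  have hq y : y \in Ell0 :: q -> height y < K.
    by move=> /(height_path vq) /= yh; apply: leq_ltn_trans yh _;
      apply: leq_ltn_trans qr rK.
  rewrite inE => /orP[/eqP->|/sub]; first by apply: hp; rewrite -pu mem_last.
  rewrite mem_cat mem_rev => /orP[/mem_belast/hp //|yq].
  by apply: hq; rewrite inE yq orbT.
have sL : size s <= L.+2.
  apply: leq_trans rL; rewrite mul2n -addnn.
  apply: (@leq_trans (size (p' ++ q)));
    first exact: uniq_leq_size (proj2 (andP uns)) sub.
  by rewrite size_cat size_rev size_belast leq_add.
have := unfold_uniq us uns hs sL.
case: s us uns sub lsv hs sL => [//|x s] us uns sub lsv hs sL /=.
case/andP => /negP[]; rewrite uv -lsv; apply: (@map_f _ _ unfold (x :: s)).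
exact: (mem_last x s).
Qed.

Lemma unfold_lift_path u p : height u + size p <= K -> path (adj e) (unfold u) p ->
  exists2 q, path lim_adj u q & map unfold q = p.
Proof.
elim: p u => [|y p IH] u /=; first by exists [::].
move=> hu /andP[uy yp].
have hK : height u < K by lia.
have [u' uu' u'y] : exists2 u', lim_adj u u' & unfold u' = y.
  case/orP: uy => uy.
    by have [u' uu' <-] := unfold_lift_out hK uy; exists u' => //; apply: lim_arc_adj.
  have [u' uu' <-] := unfold_lift_in hK uy; exists u' => //.
  by rewrite lim_adjC lim_arc_adj.
have [||q u'q qE] := IH u'; last by exists (u' :: q); rewrite /= ?uu' ?u'y ?qE.
- by move: (height_adj uu'); lia.
- by rewrite u'y.
Qed.

(** The isomorphism is [unfold] restricted to the ball: path lifting makes it onto, the absence of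
    short cycles makes it injective. *)
Lemma nbhd_limit_iso (mk : V -> kind) R : (forall v, of_kind (mk v) v) ->
  R.+1 < K -> 2 * R.+1 <= L.+2 ->
  mgraph_iso (nbhd R leaf_limit) (nbhd R (MGraph (fun u v => e u v) mk w)).
Proof.
move=> mkP RK RL; set G := MGraph _ _ _.
have GP r u v : @dist_le G r u v <-> nearby e r u v.
  split; elim: r u => [|r IH] u /=; first by move->.
  - case=> [->|[x [ux /IH xv]]]; first by rewrite eqxx.
    apply/orP; right; apply/existsP; exists x; rewrite xv andbT /adj.
    by case: ux => ->; rewrite ?orbT.
  - by move/eqP.
  - case/orP => [/eqP ->|/existsP[x /andP[ux /IH xv]]]; first by left.
    by right; exists x; split=> //; apply/orP.
have ball_height r v : ball_set leaf_limit r v -> height v <= r.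
  case/lim_distP => p [pp <- pr]; apply: leq_trans pr.
  exact: (height_path pp (mem_last _ _)).
have fP (v : set_type (ball_set leaf_limit R)) : unfold (val v) \in ball_set G R.
  apply/mem_set/GP; have hv := ball_height _ _ (set_mem (valP v)).
  apply: (nearby_leq hv); apply: (unfoldP _).2.
  by apply: leq_trans hv _; apply: ltnW; apply: ltnW.
pose f (v : vertex (nbhd R leaf_limit)) : vertex (nbhd R G) :=
  exist (fun y => y \in ball_set G R) _ (fP v).
have ballS v : ball_set leaf_limit R v -> ball_set leaf_limit R.+1 v.
  by case/lim_distP => p [pp pE pr]; apply/lim_distP; exists p; split=> //; apply: leqW.
have fI : injective f.
  move=> u v /(congr1 val) /= uv; apply: val_inj.
  apply: (unfold_inj RK RL) uv; apply: ballS; exact: set_mem (valP _).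
have fS (y : vertex (nbhd R G)) : exists v, f v = y.
  have /GP := set_mem (valP y).
  have near_pathP r u v : nearby e r u v ->
      exists p, [/\ path (adj e) u p, last u p = v & size p <= r].
    elim: r u => [|r IH] u /=; first by move/eqP->; exists [::].
    case/orP => [/eqP->|/existsP[x /andP[ux /IH[p [xp pv pr]]]]]; first by exists [::].
    by exists (x :: p); rewrite /= ux.
  case/near_pathP => p [pp pE pr].
  have [|q qq qE] := @unfold_lift_path Ell0 p _ pp; first by rewrite /= add0n; lia.
  have qR : ball_set leaf_limit R (last Ell0 q).
    by apply/lim_distP; exists q; split=> //; rewrite -(size_map unfold) qE.
  exists (exist (fun v => v \in ball_set leaf_limit R) _ (mem_set qR));
    apply: val_inj => /=.
  by rewrite -pE -qE; exact: (esym (last_map unfold q Ell0)).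
exists f; split.
- exists (fun y => sval (cid (fS y))) => [v|y]; last exact: svalP (cid (fS y)).
  by apply: fI; exact: svalP (cid (fS (f v))).
- exact: val_inj.
- move=> v; have hv := ball_height _ _ (set_mem (valP v)).
  apply: (@kind_uniq _ _ (unfold (val v))); first exact: mkP.
  by apply: (unfoldP _).1; apply: leq_trans hv _; apply: ltnW; apply: ltnW.
move=> u v; have hu := ball_height _ _ (set_mem (valP u)).
have hv := ball_height _ _ (set_mem (valP v)).
have huK : height (val u) < K by apply: leq_ltn_trans hu _; apply: ltnW.
have hvK : height (val v) < K by apply: leq_ltn_trans hv _; apply: ltnW.
split=> /= uv; last exact: unfold_arc (ltnW huK) (ltnW hvK) uv.
(* The lift [v'] is only known to be within R + 1 of the root, which is why injectivity is required
   at that radius. *)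
have [v' uv' v'v] := unfold_lift_out huK uv.
suff <- : v' = val v by [].
apply: (unfold_inj RK RL) v'v; last by apply: ballS; exact: set_mem (valP v).
have /lim_distP[p [pp pE pr]] := set_mem (valP u).
apply/lim_distP; exists (rcons p v'); rewrite rcons_path last_rcons size_rcons pp pE.
by rewrite (lim_arc_adj uv').
Qed.

End Local.

(** * The proportion of bad leaves *)

Lemma card_eq1 (T : finType) (P : pred T) x :
  P x -> (forall y, P y -> y = x) -> #|P| = 1.
Proof.
move=> Px PE; rewrite -[RHS](card1 x); apply: eq_card => y.
by rewrite unfold_in; apply/idP/eqP => [/PE|->].
Qed.

Lemma card_eq2 (T : finType) (P : pred T) x y :
  x != y -> P x -> P y -> (forall z, P z -> z = x \/ z = y) -> #|P| = 2.
Proof.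
move=> xy Px Py PE; have <- : #|pred2 x y| = 2 by rewrite card2 xy.
apply: eq_card => z; rewrite [RHS]inE unfold_in.
by apply/idP/orP => [/PE[]->|[] /eqP ->]; rewrite ?eqxx; [left|right| |].
Qed.

(** A caterpillar without reticulations: [inl 0] is the root, the other [inl i] form the spine with
    leaf [inr i] attached, and the last one also carries [inr 0]. It shows that the average over
    classes has a nonzero denominator. *)
Definition caterpillar_edge n : rel ('I_n + 'I_n) := fun s t =>
  match s, t with
  | inl i, inl j => nat_of_ord j == i.+1
  | inl i, inr j => (0 < i) && (nat_of_ord j == i) || (i.+1 == n) && (nat_of_ord j == 0)
  | _, _ => false
  end.

Lemma caterpillar_net n : 1 < n -> simplex_net (@caterpillar_edge n) inr.
Proof.
case: n => [|[|n]] // _; set e := @caterpillar_edge n.+2.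
pose T : finType := ('I_n.+2 + 'I_n.+2)%type.
have inl_eq (i j : 'I_n.+2) : i = j :> nat -> inl i = inl j :> T by move/val_inj->.
have inr_eq (i j : 'I_n.+2) : i = j :> nat -> inr i = inr j :> T by move/val_inj->.
have next (i : 'I_n.+2) : i < n.+1 -> exists j : 'I_n.+2, j = i.+1 :> nat.
  by move=> iN; exists (inord i.+1); rewrite inordK.
have droot : vdeg e (inl ord0) = (0, 1).
  congr (_, _); first by apply: eq_card0 => -[i|i].
  have [j jE] := next ord0 isT.
  apply: (@card_eq1 T _ (inl j)); first by rewrite /= jE.
  by move=> [k|k] //= /eqP kE; apply: inl_eq; rewrite kE jE.
have dtree (i : 'I_n.+2) : 0 < i -> vdeg e (inl i) = (1, 2).
  move=> i0; congr (_, _).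
    have jP : i.-1 < n.+2 by have := ltn_ord i; lia.
    apply: (@card_eq1 T _ (inl (Ordinal jP))); first by rewrite /= prednK.
    by move=> [k|k] //= /eqP kE; apply: inl_eq; rewrite /= kE.
  have [iE|iE] := eqVneq i.+1 n.+2.
    apply: (@card_eq2 T _ (inr i) (inr ord0)).
    - by apply/eqP => -[] /(congr1 val) /= i00; rewrite i00 in i0.
    - by rewrite /= i0 eqxx.
    - by rewrite /= iE eqxx orbT.
    move=> [k|k] /=; first by move/eqP => kE; have := ltn_ord k; lia.
    by case/orP => /andP[_ /eqP kE]; [left|right]; apply: inr_eq.
  have [|j jE] := next i; first by have := ltn_ord i; move/eqP: iE; lia.
  apply: (@card_eq2 T _ (inl j) (inr i)) => //=; rewrite ?jE ?i0 ?eqxx //.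
  move=> [k|k] /=; first by move/eqP => kE; left; apply: inl_eq; rewrite kE.
  by rewrite (negPf iE) orbF => /eqP kE; right; apply: inr_eq.
have dleaf (i : 'I_n.+2) : vdeg e (inr i) = (1, 0).
  congr (_, _); last exact: eq_card0.
  have [i0|i0] := eqVneq (nat_of_ord i) 0.
    apply: (@card_eq1 T _ (inl ord_max)); first by rewrite /= i0 eqxx orbT.
    move=> [k|k] //=; rewrite i0; case/orP => /andP[k0 /eqP kE]; apply: inl_eq.
      by rewrite -kE in k0.
    by move/eqP: k0 => [->].
  apply: (@card_eq1 T _ (inl i)); first by rewrite /= eqxx lt0n i0.
  move=> [k|k] //=; rewrite (negPf i0) andbF orbF => /andP[_ /eqP kE].
  exact: inl_eq.
have zero (i : 'I_n.+2) : ~~ (0 < i) -> i = ord0 by move=> i0; apply: val_inj => /=;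
  lia.
split.
- exists (fun s => match s with inl i => nat_of_ord i | inr _ => n.+2 end).
  by move=> [i|i] [j|j] //= /eqP ->.
- exists (inl ord0 : T); first by rewrite /rootv droot.
  move=> [i|i]; last by rewrite /leafv dleaf.
  have [/dtree di _|/zero -> /eqP//] := boolP (0 < i).
  by rewrite /treev di /= orbT.
- by move=> i j [].
- move=> [i|i]; last by rewrite /leafv dleaf; apply/codomP; exists i.
  have -> : leafv e (inl i) = false.
    by rewrite /leafv; have [/dtree ->|/zero ->] := boolP (0 < i); rewrite ?droot.
  by apply/negP => /codomP[].
- move=> [i|i]; last by rewrite /leafv dleaf.
  have [i0 _|/zero -> _] := boolP (0 < i).
    by exists (inr i); rewrite /= ?i0 ?eqxx // /leafv dleaf eqxx orbT.
  have [j jE] := next ord0 isT; exists (inl j); first by rewrite /= jE.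
  by rewrite /treev dtree // jE.
- move=> [i|i]; rewrite /retv ?dleaf //.
  by have [/dtree ->|/zero ->] := boolP (0 < i); rewrite ?droot.
Qed.

Lemma classes_neq0 n : 1 < n ->
  0 < #|` fset_set [set: network_class n]%classic|%fset.
Proof.
move=> /caterpillar_net /realize[N _].
rewrite cardfs_gt0; apply/fset0Pn; exists (\pi_(network_class n)%qT N).
exact: mem_classes.
Qed.

Lemma kind_of_ok n (g : lgraph n) : simplex_net (@edge n g) (@label n g) ->
  forall v : vert g, of_kind (@edge n g) (kind_of v) v.
Proof.
move=> N v; rewrite /kind_of; have := net_kind N v.
rewrite /rootv; case: ifP => //= _;
  rewrite -[is_leaf v]/(leafv _ v) -[is_tree v]/(treev _ v).
by case: ifP => //= _; case: ifP.
Qed.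

Definition is_bad_leaf n R (N : network n) (v : vert (val N)) : bool :=
  is_leaf v && ~~ `[< mgraph_iso (nbhd R leaf_limit) (nbhd R (rooted_at v)) >].

(** Each bad leaf is within R + 2 of a bad vertex. The root and the [bif] vertices together are as
    many as the [tleaf] ones, hence the factor 2. *)
Lemma card_bad_leaf n R (N : network n) :
  #|@is_bad_leaf n R N| <= 4 ^ R.+2 *
    (2 * #|tleaf (@edge n (val N))| + #|short_parent (@edge n (val N)) (2 * R)|).
Proof.
have net := network_net N; set e := @edge n (val N).
pose bad := bad_vertex e (2 * R).
have badP v : is_bad_leaf R v -> [exists x, bad x && nearby e R.+2 x v].
  case/andP => lv /asboolP; apply: contra_notT => /existsPn nbad.
  apply: (@nbhd_limit_iso _ _ _ _ net R.+2 (2 * R) v lv _ _ R (kind_of_ok net)) => //.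
    by move=> x vx; move: (nbad x); rewrite (nearby_sym vx) andbT.
  by rewrite mulnS.
apply: (@leq_trans #|[pred v | [exists x, bad x && nearby e R.+2 x v]]|).
  by apply/subset_leq_card/fintype.subsetP => v; rewrite inE => /badP.
apply: leq_trans (@card_bigcup_le _ bad (nearby e R.+2) (4 ^ R.+2) _) _.
  by move=> x _; apply: card_nearby; apply: net_deg3 net.
rewrite mulnC leq_mul2l; apply/orP; right.
have := card_root net; have := card_bif net; rewrite -/e => cb cr.
have : #|bad| <= #|rootv e| + (#|bif e| + (#|tleaf e| + #|short_parent e (2 * R)|)).
  apply: leq_trans (card_orP _ _) _; rewrite leq_add2l.
  apply: leq_trans (card_orP _ _) _; rewrite leq_add2l.
  exact: card_orP.
by rewrite cr; lia.
Qed.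

(** This is the o(n) bound on the mean, in natural numbers: for every T the mean is eventually at
    most A n / T. *)
Lemma sum_bad_leaf R : exists A, forall T, exists n0, forall n, n0 <= n ->
  T * \sum_(c <- fset_set [set: network_class n]%classic) #|@is_bad_leaf n R (repr c)| <=
  A * (n * #|` fset_set [set: network_class n]%classic|%fset).
Proof.
pose q := 4 ^ R.+2; pose L2 := (2 * R).+2; pose B := 4 ^ L2.
(* Up to the factor q, the bounds below add up to c (36 n + 18 T^2 + 8 T B); the last two terms are
   at most n, whence 37. The term 4 L2 in the threshold serves the bound on [s]. *)
exists (37 * q) => T; exists (18 * T ^ 2 + 8 * T * B + 4 * L2 + 1) => n nn.
set C := fset_set _; set c := #|` C|%fset.
pose m (k : network_class n) := #|tleaf (@edge n (val (repr k)))|.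
pose s (k : network_class n) := #|short_parent (@edge n (val (repr k))) (2 * R)|.
pose r (k : network_class n) := #|retv (@edge n (val (repr k)))|.
have n0 : 0 < n by lia.
have H1 : \sum_(k <- C) m k * (m k).-1 <= c * (2 * n) by apply: sum_tleaf.
have H2 : \sum_(k <- C) s k * (2 * r k - 2 * L2) <= c * (4 * n * B).
  exact: sum_short_parent.
have H3 : T * \sum_(k <- C) m k <= c * (T ^ 2 + 2 * n).
  rewrite mulnDr; apply: leq_trans (leq_add (leqnn _) H1).
  rewrite big_distrr /= /c -sum1_size big_distrl -big_split /=; apply: leq_sum => k _.
  (* T m <= T^2 + m (m - 1), since either m <= T or m - 1 >= T. *)
  by rewrite mul1n; case: (leqP (m k) T) => mT; nia.
have H4 : \sum_(k <- C) s k <= c * (8 * B) + 16 * \sum_(k <- C) m k.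
  rewrite -(leq_pmul2l n0) mulnDr.
  have -> : n * (c * (8 * B)) = 2 * (c * (4 * n * B)) by lia.
  apply: (@leq_trans (2 * (\sum_(k <- C) s k * (2 * r k - 2 * L2)) +
    n * (16 * \sum_(k <- C) m k))); last by rewrite leq_add2r leq_mul2l H2 orbT.
  rewrite !big_distrr -big_split /=; apply: leq_sum => k _.
  have mr : m k + r k = n by apply: card_tleaf (network_net _).
  have sn : s k <= 4 * n.
    by apply: leq_trans (max_card _) (card_net (network_net (repr k))).
  have : 4 * L2 <= n by lia.
  (* If 4m <= n then r >= 3n/4 and 2r - 2 L2 >= n; otherwise s <= 4n < 16m. *)
  case: (leqP (4 * m k) n) => mn Ln.
    have -> : n * s k = s k * n by rewrite mulnC.
    apply: leq_trans (leq_addr _ _); rewrite mulnCA leq_mul2l; apply/orP; right; lia.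
  apply: leq_trans (leq_addl _ _); rewrite leq_mul2l; apply/orP; right; lia.
have H5 : \sum_(k <- C) #|@is_bad_leaf n R (repr k)| <=
    q * (2 * (\sum_(k <- C) m k) + \sum_(k <- C) s k).
  rewrite big_distrr -big_split big_distrr /=; apply: leq_sum => k _.
  exact: card_bad_leaf.
apply: (leq_trans (leq_mul (leqnn T) H5)).
rewrite mulnCA [37 * q]mulnC -mulnA leq_mul2l; apply/orP; right.
apply: (@leq_trans (18 * (c * (T ^ 2 + 2 * n)) + T * (c * (8 * B)))); last first.
  have : c * (18 * T ^ 2 + 8 * T * B) <= c * n by rewrite leq_mul2l; lia.
  by nia.
by nia.
Qed.

Lemma mgraph_iso_sym G H : mgraph_iso G H -> mgraph_iso H G.
Proof.
case=> f [[h fK hK] fr fm fa]; exists h; split; first by exists f.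
- by rewrite -fr fK.
- by move=> v; rewrite -fm hK.
- by move=> u v; rewrite -fa !hK.
Qed.

Lemma mgraph_iso_trans G H I : mgraph_iso G H -> mgraph_iso H I -> mgraph_iso G I.
Proof.
case=> f [fB fr fm fa] [h [hB hr hm ha]]; exists (h \o f); split.
- exact: bij_comp.
- by rewrite /= fr.
- by move=> v; rewrite /= hm.
- by move=> u v; rewrite /= ha.
Qed.

(** * Convergence of the leaf law *)

Import Order.TTheory GRing.Theory Num.Theory.
Import numFieldNormedType.Exports.

Section LeafLaw.
Variable R : realType.
Local Open Scope ring_scope.

(** If [G] is the limit ball, the leaves that do not see [G] are exactly the bad ones; if not, every
    leaf that sees [G] is bad. *)
Lemma leaf_freq_limit n r G (N : network n) : (0 < n)%N ->
  `|deterministic_law R leaf_limit r G - leaf_freq R r G N| <=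
  #|@is_bad_leaf n r N|%:R / n%:R.
Proof.
move=> n0; rewrite /leaf_freq /deterministic_law.
have -> : #|[pred v : vert (val N) | is_leaf v]| = n by apply: card_leaf (network_net N).
have nR : (0 : R) < n%:R by rewrite ltr0n.
case: asboolP => [LG|nLG]; last first.
  rewrite sub0r normrN ger0_norm ?divr_ge0 // ler_pM2r ?invr_gt0 // ler_nat.
  apply/subset_leq_card/fintype.subsetP => v; rewrite inE => /andP[lv /asboolP vG].
  rewrite unfold_in /is_bad_leaf lv; apply/asboolP => Lv; apply: nLG.
  exact: mgraph_iso_trans Lv vG.
have -> : (true%:R : R) = n%:R / n%:R by rewrite divff // gt_eqF.
rewrite -mulrBl normrM [X in _ * X]ger0_norm ?invr_ge0 // ler_pM2r ?invr_gt0 //.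
set g := #|_|; set b := #|_|.
have gb : (g + b)%N = n.
  rewrite -(card_leaf (network_net N)).
  rewrite -(cardID [pred v | `[< mgraph_iso (nbhd r (rooted_at v)) G >]] (leafv _)).
  congr (_ + _)%N; apply: eq_card => v; rewrite !inE.
  rewrite unfold_in /is_bad_leaf andbC; congr (~~ _ && _).
  apply/asboolP/asboolP => [Lv|vG];
    first exact: mgraph_iso_trans (mgraph_iso_sym Lv) LG.
  exact: mgraph_iso_trans LG (mgraph_iso_sym vG).
by rewrite -gb natrD addrC addKr ger0_norm.
Qed.

End LeafLaw.

Theorem theorem1p9 (R : realType) :
  infinite_set [set: vertex leaf_limit]%classic /\
  local_weak_cvg (@uniform_leaf_law R) (deterministic_law R leaf_limit).
Proof.
split.
  move=> fin; apply: infinite_nat.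
  rewrite -(preimage_setT (fun i : nat => SpineV SpineP (Posz i))).
  by apply: finite_preimage fin => i j _ _ [].
move=> r G _; have [A AP] := sum_bad_leaf r.
apply/cvgrPdist_lt => eps eps0.
(* Chosen so that A / T < eps. *)
pose T := (Num.truncn (A%:R / eps)).+1.
have AT : (A%:R < eps * T%:R)%R.
  by rewrite mulrC -ltr_pdivrMr // truncnS_gt.
have [n0 n0P] := AP T.
near=> n.
have nn0 : (n0 <= n)%N by near: n; exact: nbhs_infty_ge.
have n1 : (1 < n)%N by near: n; exact: nbhs_infty_ge.
rewrite /uniform_leaf_law fsbig_finite /=; last exact: finite_classes.
have := n0P n nn0; have := classes_neq0 n1.
set C := fset_set _ => C0 CP.
have nR : (0 < n%:R :> R)%R by rewrite ltr0n ltnW.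
have CR : (0 < #|` C|%fset%:R :> R)%R by rewrite ltr0n.
rewrite -[X in (X - _)%R](mulfK (lt0r_neq0 CR)) -mulrBl normrM.
rewrite [X in (_ * X)%R]ger0_norm ?invr_ge0 // ltr_pdivrMr //.
(* The limit value is spread as a constant over the classes, so that the averages are compared class
   by class. *)
have -> : (deterministic_law R leaf_limit r G * #|` C|%fset%:R =
    \sum_(c <- C) deterministic_law R leaf_limit r G)%R.
  by rewrite big_const_seq count_predT iter_addr_0 mulr_natr.
rewrite -sumrB; apply: (le_lt_trans (ler_norm_sum _ _ _)).
apply: (@le_lt_trans _ _ (\sum_(c <- C) (#|@is_bad_leaf n r (repr c)|%:R / n%:R))%R).
  by apply: ler_sum => c _; apply: leaf_freq_limit; apply: ltnW.
rewrite -mulr_suml -natr_sum ltr_pdivrMr //.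
have T0 : (0 < T%:R :> R)%R by rewrite ltr0n.
rewrite -(ltr_pM2l T0) -natrM.
apply: (@le_lt_trans _ _ ((A * (#|` C|%fset * n))%N%:R)%R);
  first by rewrite ler_nat (mulnC _ n).
rewrite !natrM.
rewrite [ltRHS]mulrC -[(eps * _ * _)%R]mulrA [ltRHS]mulrAC.
by rewrite ltr_pM2r // mulr_gt0.
Unshelve. all: by end_near.
Qed.
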